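(* There is a unique probability measure $\mu_g$ on the circle $S^1=[0,1)$ which is mutually absolutely continuous with respect to Lebesgue measure and is preserved by $g$. Both Radon--Nikodym derivatives $dx/d\mu_g$ and $d\mu_g/dx$ are essentially bounded. Furthermore, the system $\{S^1,\mu_g,g\}$ is exponentially CF-mixing.
   Context: For irrational $\theta\in(0,1)$ write $\theta=[a_1,a_2,a_3,\ldots]=\cfrac{1}{a_1+\cfrac{1}{a_2+\ddots}}$ with $a_i=a_i(\theta)\in\mathbb{N}=\{1,2,\ldots\}$ for its continued fraction expansion, and let $\gamma(\theta)=\frac1\theta-a_1=[a_2,a_3,\ldots]$ be the Gauss map. The map $g$ is defined on irrationals (hence Lebesgue-almost everywhere on $S^1$, identified with $[0,1)$) by $$g(\theta)=\begin{cases}[a_2+1,a_3,\ldots]=1-\theta & (a_1=1)\\ [1,a_2,a_3,\ldots]=\frac{1}{1+\gamma(\theta)} & (a_1 \text{ odd},\ a_1\neq 1)\\ [a_3,a_4,\ldots]=\gamma^2(\theta) & (a_1\text{ even}).\end{cases}$$ Here $dx$ denotes Lebesgue measure. CF-mixing (continued fraction mixing) is with respect to the countable partition (up to a countable set) $\mathcal{C}$ of $(0,1)$ into the open intervals $\left(\frac12,1\right)$, $\left(\frac{1}{2k+2},\frac{1}{2k+1}\right)$ and $\left(\frac{m}{2nm+1},\frac{m+1}{2n(m+1)+1}\right)$, $k,n,m=1,2,\ldots$. For $r\geq1$ set $$\psi(r)=\sup\left\{\left|\frac{\mu_g(U\cap g^{-(s+r-1)}V)}{\mu_g(U)\mu_g(V)}-1\right|\right\},$$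 the supremum being over all $s\ge 1$, all $U$ in the $\sigma$-algebra generated by $\mathcal{C},g^{-1}\mathcal{C},\ldots,g^{-(s-1)}\mathcal{C}$ with $\mu_g(U)>0$, and all Borel sets $V$ with $\mu_g(V)>0$. The system is CF-mixing if $\psi(1)<\infty$ and $\psi(r)\to0$ as $r\to\infty$, and exponentially CF-mixing if in addition $\psi(r)\le K\kappa^r$ for all $r\geq 1$, for some constants $K>0$ and $0<\kappa<1$. *)

(* Defs.v *)
From HB Require Import structures.
From mathcomp Require Import all_boot all_order all_algebra.
From mathcomp Require Import all_classical all_reals all_analysis.

Set Implicit Arguments.
Unset Strict Implicit.
Unset Printing Implicit Defensive.

Import Order.TTheory GRing.Theory Num.Theory.
Import numFieldNormedType.Exports.

Local Open Scope classical_set_scope.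
Local Open Scope ring_scope.

Section ContinuedFractionMap.
Variable R : realType.
Implicit Types (theta : R) (n s r : nat).

(* The circle S^1, identified with [0, 1). *)
Definition circle : set (measurableTypeR R) := [set` `[0, 1[].

Definition irr01 : set (measurableTypeR R) :=
  [set theta | 0 < theta < 1 /\ irrational theta].

(* a_1(theta); the later digits are a_(i+1)(theta) = a_1(gamma^i(theta)),
   by [irr01_cf] below. *)
Definition cf_digit1 theta : nat := Num.truncn theta^-1.

Definition gauss theta : R := theta^-1 - (cf_digit1 theta)%:R.

(* Only the values on [irr01] are meaningful. *)
Definition g theta : R :=
  if cf_digit1 theta == 1%N then 1 - theta
  else if odd (cf_digit1 theta) then (1 + gauss theta)^-1
  else gauss (gauss theta).

Lemma irr01_cf theta : irr01 theta ->
  [/\ (0 < cf_digit1 theta)%N, irr01 (gauss theta) &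
      theta = ((cf_digit1 theta)%:R + gauss theta)^-1].
Proof.
case=> /andP[t0 t1] it.
have v1 : 1 < theta^-1 by rewrite invf_gt1.
have v0 : 0 <= theta^-1 by rewrite invr_ge0 ltW.
have /andP[le_dv lt_vd] := Num.Theory.truncn_itv v0.
split; last by rewrite /gauss addrC subrK invrK.
  by rewrite /cf_digit1 Num.Theory.truncn_gt0 ltW.
have ig : irrational (gauss theta).
  move=> [q _ qE]; apply: it; exists (q + (cf_digit1 theta)%:R)^-1 => //.
  by rewrite fmorphV rmorphD/= rmorph_nat qE /gauss subrK invrK.
split=> //; apply/andP; split; last by rewrite /gauss ltrBlDl natr1.
rewrite lt_neqAle /gauss subr_ge0 le_dv andbT eq_sym.
by apply/eqP => g0; apply: ig; exists 0 => //; rewrite rmorph0 /gauss g0.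
Qed.

Lemma irr01_g theta : irr01 theta -> irr01 (g theta).
Proof.
move=> it; have [d0 ig _] := irr01_cf it.
rewrite /g; case: eqP => [_|_]; [|case: ifP => _].
- case: it => /andP[t0 t1] it; split; first by rewrite subr_gt0 t1 gtrBl.
  move=> [q _ qE]; apply: it; exists (1 - q) => //.
  by rewrite rmorphB rmorph1 /= qE subKr.
- case: ig => /andP[t0 t1] ig; split.
    have p : 0 < 1 + gauss theta by rewrite addr_gt0.
    by rewrite invr_gt0 p/= invf_lt1// ltrDl.
  move=> [q _ qE]; apply: ig; exists (q^-1 - 1) => //.
  by rewrite rmorphB rmorph1 fmorphV /= qE invrK addrC addKr.
- by have [] := irr01_cf ig.
Qed.

(* Preimage under g seen as a partial map with domain [irr01]; the preimage
   under g^n is [iter n g_preimage V]. *)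
Definition g_preimage (V : set (measurableTypeR R)) :
  set (measurableTypeR R) := irr01 `&` g @^-1` V.

Lemma measurable_circle : measurable circle.
Proof. exact: measurable_itv. Qed.

Lemma lebesgue_circle_fin : (lebesgue_measure circle < +oo)%E.
Proof. by rewrite lebesgue_measure_itv/= lte_fin ltr01 -EFinB ltry. Qed.

(* Lebesgue measure on the circle, as a finite measure on the line vanishing
   off [0, 1). *)
Definition dx : set (measurableTypeR R) -> \bar R :=
  mfrestr measurable_circle lebesgue_circle_fin.

HB.instance Definition _ := FiniteMeasure.on dx.

(* Up to endpoints and rationals these are the sets {a_1 = 1},
   {a_1 = 2k+1} and {a_1 = 2n, a_2 = m}. *)
Definition cf_partition : set (set (measurableTypeR R)) :=
  [set [set` `]2^-1, 1[]]
  `|` [set A | exists k, (0 < k)%N /\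
        A = [set` `](2 * k + 2)%:R^-1, (2 * k + 1)%:R^-1[]]
  `|` [set A | exists n m, [/\ (0 < n)%N, (0 < m)%N &
        A = [set` `](m%:R / (2 * n * m + 1)%:R),
                    (m.+1%:R / (2 * n * m.+1 + 1)%:R)[]]].

Definition cf_sigma_algebra s : set (set (measurableTypeR R)) :=
  <<s circle, [set U | exists i A, [/\ (i < s)%N, cf_partition A &
                                       U = iter i g_preimage A]] >>.

Section Mixing.
Variable mu : probability (measurableTypeR R) R.

(* As dx vanishes off the circle, mu `<< dx also forces mu to be carried by
   the circle. *)
Definition equivalent_to_dx : Prop := mu `<< dx /\ dx `<< mu.

Definition preserved_by_g : Prop :=
  forall V, measurable V -> V `<=` circle -> mu (g_preimage V) = mu V.

Definition dmu_dx : measurableTypeR R -> \bar R :=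
  Radon_Nikodym (charge_of_finite_measure mu) dx.

Definition dx_dmu : measurableTypeR R -> \bar R :=
  Radon_Nikodym (charge_of_finite_measure dx) mu.

Definition psi r : \bar R :=
  ereal_sup [set x | exists s U V,
    [/\ (0 < s)%N,
        cf_sigma_algebra s U /\ (0 < mu U)%E,
        [/\ measurable V, V `<=` circle & (0 < mu V)%E] &
        x = (`| fine (mu (U `&` iter (s + r - 1) g_preimage V))
                / (fine (mu U) * fine (mu V)) - 1 |)%:E]].

Definition CF_mixing : Prop :=
  (psi 1 < +oo)%E /\ psi r @[r --> \oo] --> 0%E.

Definition exponentially_CF_mixing : Prop :=
  CF_mixing /\
  exists K kappa : R, [/\ 0 < K, 0 < kappa < 1 &
    forall r, (1 <= r)%N -> (psi r <= (K * kappa ^+ r)%:E)%E].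

End Mixing.

End ContinuedFractionMap.

(* Main.v *)
From HB Require Import structures.
Require Import Defs.
From mathcomp Require Import all_boot all_order all_algebra.
From mathcomp Require Import all_classical all_reals all_analysis.
From mathcomp Require Import measurable_realfun ess_sup_inf ring lra.
Import Order.TTheory GRing.Theory Num.Theory.
Import numFieldNormedType.Exports.
Local Open Scope classical_set_scope.
Local Open Scope ring_scope.

Set Implicit Arguments.
Unset Strict Implicit.
Unset Printing Implicit Defensive.

(** The map [g] is piecewise Moebius. With [t = m + y] and [N = n + 1], its
    inverse branches are the flip [1 - y], for [a_1 = 1], and
    [t / (2 N t + 1)], where [m = 0] stands for [a_1 = 2 N + 1] and [m >= 1]
    for [a_1 = 2 N], [a_2 = m]. The flip is defined on the lower half
    [(0, 1/2)], the branches with [m = 0] on the upper half [[1/2, 1)], and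
    the other ones on both.

    The density [rho] is [2 / (1 - y^2)] on the lower half and [1 / y] on the
    upper half. It comes from the natural extension of [g]: let the same
    Moebius maps act on a second coordinate [x], with [|x| > 1] over the lower
    half and [x < 0] over the upper half. This action is a bijection up to a
    null set, it preserves [dx dy / (x - y)^2], and integrating [x] out gives
    [rho]. The proof below only checks the outcome, the telescoping identity
    [sum_weight], which makes [weight b y] the transition probabilities of a
    Markov chain that jumps from [y] to its preimages under [g]. As
    [1 <= rho <= 8/3], the normalised measure is equivalent to Lebesgue
    measure on the circle, with both derivatives bounded.

    The transition operator [transferR] of that chain is dual to [g] in
    [L^2(rho dx)] ([rho_int_g_preimage]). Two estimates carry the mixing.
    First, [regular_transfer]: the operator contracts by [71/72] the smallest
    [A] for which a density is [regular], a bound on its oscillation and on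
    its Lipschitz constants on the two halves. The Lipschitz constants
    decrease because all branches but the flip contract, and the flip only
    leads from the lower half to the upper half, where a smaller constant is
    required; the oscillation decreases because one branch of probability at
    least [1/24] sends everything into a short interval. Hence the iterates
    of a regular density converge uniformly and exponentially fast to a
    constant, which is exponential decay of correlations
    ([mixing_bound]). Second, bounded distortion ([cylinder_density],
    [distorted_regular]): pushed forward by [g^s], the invariant measure
    restricted to a union [U] of cylinders of rank [s] has a regular density,
    whose constant is at most 36 times the mass of [U], whatever [s] is.
    Together they bound [psi].

    For uniqueness, let [nu] be another invariant probability and [P] the set
    where its density with respect to [mu] exceeds 1. Comparing masses of [P]
    and of its preimage shows that they differ by a null set; decay of
    correlations makes such a set null or conull ([invariant_set_trivial]), so
    [nu <= mu] or [mu <= nu], and two comparable probabilities are equal. *)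

(** * Countable sums of nonnegative terms *)

Section CountableSums.
Context {R : realType} {B : countType}.
Local Open Scope ereal_scope.
Implicit Types a : B -> \bar R.

(** The bridge to series: sums over a countable type are enumerated by
    [pickle_inv], with 0 at the indices that code nothing. *)
Lemma esum_nneseries a : (forall b, 0 <= a b) ->
  \esum_(b in [set: B]) a b = \sum_(0 <= i <oo) oapp a 0 (@pickle_inv B i).
Proof.
move=> a0; rewrite nneseries_esumT; last by move=> i; case: pickle_inv => /=.
transitivity (\esum_(i in pickle @` [set: B]) oapp a 0 (@pickle_inv B i)).
  rewrite esum_image; last by apply: in2W; apply: pcan_inj (@pickleK_inv B).
  by apply: eq_esum => b _; rewrite pickleK_inv.
rewrite esum_mkcond; apply: eq_esum => i _.
case: ifPn => //; rewrite notin_setE => Ni.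
have := @pickle_invK B i; case: (pickle_inv i) => //= b bi.
by exfalso; apply: Ni; exists b.
Qed.

Lemma esumZl a (r : R) : (forall b, 0 <= a b) -> (0 <= r)%R ->
  \esum_(b in [set: B]) (r%:E * a b) = r%:E * \esum_(b in [set: B]) a b.
Proof.
move=> a0 r0; rewrite !esum_nneseries//; last by move=> b; rewrite mule_ge0.
rewrite -nneseriesZl; last by move=> i _; case: pickle_inv => /=.
by apply: eq_eseriesr => i _; case: pickle_inv => //=; rewrite mule0.
Qed.

Lemma esum_point (b0 : B) (e : \bar R) : 0 <= e ->
  \esum_(b in [set: B]) (if b == b0 then e else 0) = e.
Proof.
move=> e0; have := @esum_set1 R B b0 (fun=> e) e0; rewrite esum_mkcond => {2}<-.
apply: eq_esum => b _; case: eqP => bb0; first by rewrite mem_set.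
by rewrite memNset.
Qed.

Context {d} {T : measurableType d} (mu : {measure set T -> \bar R}).

Lemma ge0_integral_esum (D : set T) (f : B -> T -> \bar R) : measurable D ->
  (forall b, measurable_fun D (f b)) -> (forall b x, 0 <= f b x) ->
  \int[mu]_(x in D) (\esum_(b in [set: B]) f b x) =
  \esum_(b in [set: B]) \int[mu]_(x in D) f b x.
Proof.
move=> mD mf f0; rewrite esum_nneseries; last by move=> b; exact: integral_ge0.
under eq_integral do rewrite esum_nneseries//.
rewrite integral_nneseries//.
- apply: eq_eseriesr => i _; case: pickle_inv => //=; exact: integral0.
- by move=> i; case: pickle_inv => //= ; exact: measurable_cst.
- by move=> i x _; case: pickle_inv => /=.
Qed.

Lemma measurable_fun_esum (D : set T) (f : B -> T -> \bar R) : measurable D ->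
  (forall b, measurable_fun D (f b)) -> (forall b x, 0 <= f b x) ->
  measurable_fun D (fun x => \esum_(b in [set: B]) f b x).
Proof.
move=> mD mf f0.
pose h i x := oapp (f ^~ x) 0 (@pickle_inv B i).
apply: (eq_measurable_fun (fun x => \sum_(0 <= i <oo) h i x)).
  by move=> x _; rewrite esum_nneseries.
apply: (@ge0_emeasurable_sum _ _ _ D h xpredT) => [i x _ _|i _]; rewrite /h.
  by case: pickle_inv => /=.
case: pickle_inv => /=; [move=> b; exact: mf|exact: measurable_cst].
Qed.

Lemma bigcup_pickle (F : B -> set T) :
  \bigcup_b F b = \bigcup_i oapp F set0 (@pickle_inv B i).
Proof.
apply/seteqP; split=> x [].
  by move=> b _ Fx; exists (pickle b) => //; rewrite pickleK_inv.
by move=> i _; case: pickle_inv => //= b Fx; exists b.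
Qed.

Lemma bigcup_countType_measurable (F : B -> set T) :
  (forall b, measurable (F b)) -> measurable (\bigcup_b F b).
Proof.
move=> mF; rewrite bigcup_pickle; apply: bigcup_measurable => i _.
by case: pickle_inv => /=.
Qed.

Lemma ge0_integral_bigcup_esum (F : B -> set T) (f : T -> \bar R) :
  (forall b, measurable (F b)) -> measurable_fun setT f ->
  (forall x, 0 <= f x) -> trivIset [set: B] F ->
  \int[mu]_(x in \bigcup_b F b) f x =
  \esum_(b in [set: B]) \int[mu]_(x in F b) f x.
Proof.
move=> mF mf f0 tF; rewrite esum_nneseries; last by move=> b; exact: integral_ge0.
rewrite bigcup_pickle ge0_integral_bigcup//.
- by apply: eq_eseriesr => i _; case: pickle_inv => //=; rewrite integral_set0.
- by move=> i; case: pickle_inv => /=.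
- exact: measurable_funTS.
- move=> i j _ _; have := @pickle_invK B i; have := @pickle_invK B j.
  case: (pickle_inv i) => [bi|]/=; last by move=> _ _ [x []].
  case: (pickle_inv j) => [bj|]/=; last by move=> _ _ [x []].
  by move=> <- <- /(tF _ _ I I) ->.
Qed.

End CountableSums.

Section Telescoping.
Context {R : realType}.
Local Open Scope ereal_scope.

Lemma esum_option (a : option (nat * nat) -> \bar R) : (forall b, 0 <= a b) ->
  \esum_(b in [set: option (nat * nat)]) a b =
  a None + \sum_(0 <= m <oo) \sum_(0 <= n <oo) a (Some (m, n)).
Proof.
move=> a0; rewrite (esumID [set None])// setTI esum_set1//; congr (_ + _).
have -> : [set: option (nat * nat)] `&` ~` [set None] =
    Some @` ([set: nat] `*`` fun=> [set: nat]).
  apply/seteqP; split=> [[p|] //= []//= _ _|[p|] //= [] q _ //].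
  by exists p.
rewrite esum_image; last by apply: in2W => x y [].
rewrite nneseries_esumT; last by move=> m; exact: nneseries_ge0.
under [RHS]eq_esum do rewrite nneseries_esumT//.
rewrite esum_esum//.
by apply: eq_esum => -[].
Qed.

Lemma nneseries_telescope (u : nat -> R) : (forall n, u n.+1 <= u n)%R ->
  (u n @[n --> \oo] --> (0 : R))%R ->
  \sum_(0 <= n <oo) (u n - u n.+1)%:E = (u 0%N)%:E.
Proof.
move=> ud u0; have -> : (fun n => \sum_(0 <= i < n) (u i - u i.+1)%:E) =
    EFin \o (fun n => u 0%N - u n)%R.
  apply/funext => n /=; rewrite sumEFin; congr EFin.
  by rewrite -opprB -(telescope_sumr u (leq0n n)) -sumrN; apply: eq_bigr => i _; rewrite opprB.
apply/cvg_lim => //; apply: cvg_EFin; first by near=> n.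
rewrite /= -[X in _ --> X]subr0; apply: cvgB u0; exact: cvg_cst.
Unshelve. all: by end_near. Qed.

End Telescoping.

(** * The invariant density and the inverse branches *)

(** [None] is the cell [a_1 = 1]; [Some (0, n)] is [a_1 = 2 n + 3]; and
    [Some (m, n)] with [m > 0] is [a_1 = 2 n + 2], [a_2 = m]. Reading an odd
    [a_1 = 2 N + 1] as [a_2 = 0] after [2 N] gives all the cells but the first
    one the same formula. *)
Definition branch_index : countType := option (nat * nat).

Section Branches.
Context {R : realType}.
Implicit Types (y z : R) (b : branch_index).

(** [2 / (1 - y ^+ 2)] and [y^-1] are the integrals of [(x - y)^-2] over
    [|x| > 1] and over [x < 0], the fibres of the natural extension. *)
Definition rho y : R :=
  if 0 < y < 1 then (if y < 2^-1 then 2 / (1 - y ^+ 2) else y^-1) else 0.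

(** The range of [g] on the cell [b], up to a null set: [g] maps [a_1 = 1] to
    the lower half, an odd [a_1 > 1] to the upper half, since its image starts
    with the digit 1, and the other cells to the whole interval. *)
Definition admissible b y : bool :=
  (0 < y < 1) && match b with
                 | None => y < 2^-1
                 | Some (0, _) => 2^-1 <= y
                 | _ => true
                 end.

Definition branch b y : R :=
  match b with
  | None => 1 - y
  | Some (m, n) => (m%:R + y) / (2 * n.+1%:R * (m%:R + y) + 1)
  end.

Definition branch_slope b y : R :=
  match b with
  | None => 1
  | Some (m, n) => (2 * n.+1%:R * (m%:R + y) + 1) ^- 2
  end.

(** The conditional probability, under [rho dx], of the cell [b] given that
    the image by [g] is [y]. *)
Definition weight b y : R :=
  if admissible b y then rho (branch b y) * branch_slope b y / rho y else 0.

Lemma rho_ge0 y : 0 <= rho y.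
Proof.
rewrite /rho; case: ifPn => // /andP[y0 y1]; case: ifPn => yh; last first.
  by rewrite invr_ge0 ltW.
by rewrite divr_ge0// subr_ge0; nra.
Qed.

Lemma rho_itv y : 0 < y < 1 -> 1 <= rho y <= 8 / 3.
Proof.
move=> y01; rewrite /rho y01; case/andP: y01 => y0 y1; case: ifPn => yh.
  rewrite ler_pdivlMr ?ler_pdivrMr; last 2 first.
  - by nra.
  - by nra.
  by apply/andP; split; nra.
rewrite -leNgt in yh.
rewrite invf_ge1// ltW//= -[leRHS]invrK lef_pV2 ?posrE//; lra.
Qed.

Lemma rho_gt0 y : 0 < y < 1 -> 0 < rho y.
Proof. by move=> /rho_itv/andP[r1 _]; exact: lt_le_trans r1. Qed.

Lemma branch_den_gt0 m n y : 0 <= y -> 0 < 2 * n.+1%:R * (m%:R + y) + 1 :> R.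
Proof.
move=> y0; rewrite ltr_wpDl// mulr_ge0// ?mulr_ge0//.
by rewrite addr_ge0.
Qed.

Lemma branch_flip_itv y : admissible None y -> 2^-1 < branch None y < 1.
Proof. by case/andP => /andP[y0 y1] yh /=; apply/andP; split; lra. Qed.

Lemma branch_Some_itv p y : 0 < y -> 0 < branch (Some p) y < 2^-1.
Proof.
case: p => m n y0 /=; have D := branch_den_gt0 m n (ltW y0).
have t0 : 0 < m%:R + y by rewrite ltr_wpDl.
rewrite divr_gt0//= ltr_pdivrMr// mulrDr mulr1 !mulrA mulVf// mul1r.
rewrite -natr1 mulrDl mul1r.
have : 0 <= n%:R * (m%:R + y) by rewrite mulr_ge0// ltW.
by move=> ?; lra.
Qed.

Lemma branch_itv b y : admissible b y -> 0 < branch b y < 1.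
Proof.
case: b => [p|] a; last by have /andP[h ->] := branch_flip_itv a; rewrite andbT (lt_trans _ h).
have /andP[/andP[y0 _] _] := a.
by have /andP[-> h] := branch_Some_itv p y0; rewrite (lt_trans h)//; lra.
Qed.

Lemma admissible01 b y : admissible b y -> 0 < y < 1.
Proof. by case/andP. Qed.

Lemma branch_slope_ge0 b y : 0 <= branch_slope b y.
Proof. by case: b => [[m n]|]//=; rewrite invr_ge0 sqr_ge0. Qed.

Lemma weight_ge0 b y : 0 <= weight b y.
Proof.
rewrite /weight; case: ifP => // _.
by rewrite divr_ge0 ?mulr_ge0 ?rho_ge0 ?branch_slope_ge0.
Qed.

Lemma weight_rho b y : weight b y * rho y =
  if admissible b y then rho (branch b y) * branch_slope b y else 0.
Proof.
rewrite /weight; case: ifPn => [a|_]; last by rewrite mul0r.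
by rewrite divfK// gt_eqF// rho_gt0// (admissible01 a).
Qed.

Lemma weight_flip y : admissible None y -> weight None y = (1 + y) / 2.
Proof.
move=> a; rewrite /weight a /rho branch_itv// (admissible01 a).
have /andP[h _] := branch_flip_itv a; rewrite ltNge (ltW h) /=.
have /andP[/andP[y0 y1] ->] := a; rewrite mulr1 invf_div.
have -> : 1 - y ^+ 2 = (1 - y) * (1 + y) by ring.
by rewrite !mulrA mulVf ?mul1r// gt_eqF// subr_gt0.
Qed.

(** The value of [rho (branch b y) * branch_slope b y] for [b = Some (m, n)]
    and [t = m + y]: it depends on [m] and [y] through [t] only, because these
    branches end in the lower half whatever [y] is. *)
Definition step_mass (n : nat) (t : R) : R :=
  2 / (((2 * n%:R + 1) * t + 1) * ((2 * n%:R + 3) * t + 1)).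

Lemma rho_slope_Some m n y : 0 < y ->
  rho (branch (Some (m, n)) y) * branch_slope (Some (m, n)) y =
  step_mass n (m%:R + y).
Proof.
move=> y0; rewrite /rho; have /andP[b0 bh] := branch_Some_itv (m, n) y0.
rewrite b0 bh (lt_trans bh) /=; last by lra.
have D := branch_den_gt0 m n (ltW y0).
have t0 : 0 < m%:R + y by rewrite ltr_wpDl.
rewrite /step_mass; move: D t0; set t := m%:R + y => D t0.
move: D; rewrite -natr1 => D.
have n0 : 0 <= n%:R :> R by [].
field; rewrite !gt_eqF//=; nra.
Qed.

Lemma step_mass_telescope n t : 0 < t ->
  step_mass n t = t^-1 / ((2 * n%:R + 1) * t + 1)
                - t^-1 / ((2 * n.+1%:R + 1) * t + 1).
Proof.
move=> t0; rewrite /step_mass -natr1.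
have n0 : 0 <= n%:R :> R by [].
by field; rewrite !gt_eqF//=; nra.
Qed.

Lemma weight_SomeE m n y : admissible (Some (m, n)) y ->
  weight (Some (m, n)) y = step_mass n (m%:R + y) / rho y.
Proof.
move=> a; rewrite /weight a rho_slope_Some//.
by case/andP: a => /andP[].
Qed.

Lemma cvg_invr_affine (c : R) (v : nat -> R) : 0 < c ->
  (forall n, c * n.+1%:R <= v n) -> (v n)^-1 @[n --> \oo] --> 0.
Proof.
move=> c0 cv; apply: (@squeeze_cvgr _ _ _ _ (fun=> 0) (fun n => c^-1 * harmonic n)).
- near=> n; have v0 : 0 < v n by apply: lt_le_trans (cv n); rewrite mulr_gt0.
  by rewrite invr_ge0 ltW//= -invfM lef_pV2 ?posrE// mulr_gt0.
- exact: cvg_cst.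
- by rewrite -[X in _ --> X](mulr0 c^-1); apply: cvgM; [exact: cvg_cst|exact: cvg_harmonic].
Unshelve. all: by end_near. Qed.

Lemma sum_step_mass t : 0 < t ->
  (\sum_(0 <= n <oo) (step_mass n t)%:E = (t^-1 - (t + 1)^-1)%:E)%E.
Proof.
move=> t0; pose v n : R := (2 * n%:R + 1) * t + 1; pose u n := t^-1 * (v n)^-1.
have n0 n : 0 <= n%:R :> R by [].
have v0 n : 0 < v n by rewrite /v; have := n0 n; nra.
rewrite (_ : t^-1 - _ = u 0%N); last first.
  by rewrite /u /v mulr0 add0r mul1r; field; rewrite !gt_eqF//=; lra.
under eq_eseriesr do rewrite step_mass_telescope//.
apply: nneseries_telescope => [n|].
  rewrite /u ler_pM2l ?invr_gt0// lef_pV2 ?posrE -?/(v _) ?v0//.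
  by rewrite /v -natr1; have := n0 n; nra.
rewrite -[X in _ --> X](mulr0 t^-1); apply: cvgM; first exact: cvg_cst.
apply: (cvg_invr_affine t0) => n; rewrite /v -natr1; have := n0 n; nra.
Qed.

(** The invariance of [rho]. The masses telescope twice: over [n] for each
    [m], to [1 / (m + y) - 1 / (m + 1 + y)], then over [m], to [1 / y] if
    [m = 0] is admissible and to [1 / (1 + y)] if not. In the latter case the
    flip supplies the missing [1 / (1 - y)]. *)
Lemma sum_weight y : 0 < y < 1 ->
  (\esum_(b in [set: branch_index]) (weight b y)%:E = 1)%E.
Proof.
move=> y01; have /andP[y0 y1] := y01; have r0 := rho_gt0 y01.
rewrite esum_option; last by move=> b; rewrite lee_fin weight_ge0.
(* [i] makes the terms with [m = 0] vanish on the lower half, where these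
   branches are not admissible. *)
pose i m := if (y < 2^-1) && (m == 0)%N then 1%N else m.
pose u m := (rho y)^-1 * ((i m)%:R + y)^-1.
have iy m : 0 < (i m)%:R + y by rewrite ltr_wpDl.
have sumn m : (\sum_(0 <= n <oo) (weight (Some (m, n)) y)%:E =
    (u m - u m.+1)%:E)%E.
  have [yh|yh] := boolP ((y < 2^-1) && (m == 0)%N).
    rewrite eseries0 => [|n _ _]; last first.
      rewrite /weight /admissible; case/andP: yh => yh /eqP ->.
      by rewrite leNgt yh andbF.
    by rewrite /u /i; case/andP: yh => -> /eqP ->; rewrite subrr.
  have a n : admissible (Some (m, n)) y.
    by rewrite /admissible y01; case: m yh => //=; rewrite andbT -leNgt.
  have my : 0 < m%:R + y by rewrite ltr_wpDl.
  under eq_eseriesr do rewrite weight_SomeE// mulrC EFinM.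
  rewrite nneseriesZl; last first.
    by move=> n _; rewrite lee_fin -rho_slope_Some// mulr_ge0 ?rho_ge0 ?branch_slope_ge0.
  rewrite sum_step_mass// -EFinM /u /i (negbTE yh) andbF -natr1 mulrBr.
  by rewrite addrAC.
under eq_eseriesr do rewrite sumn.
rewrite (_ : (\sum_(_ <= _ <oo) _)%E = (u 0%N)%:E); last first.
  apply: nneseries_telescope => [m|].
    rewrite ler_pM2l ?invr_gt0// lef_pV2 ?posrE// lerD2r ler_nat.
    by rewrite /i andbF; case: ifP => // /andP[_ /eqP->].
  rewrite -[X in _ --> X](mulr0 (rho y)^-1); apply: cvgM; first exact: cvg_cst.
  apply: (cvg_invr_affine y0) => m.
  have [n0 im] : 0 <= m%:R :> R /\ m%:R <= (i m)%:R :> R.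
    by split => //; rewrite ler_nat /i; case: ifP => // /andP[_ /eqP->].
  by rewrite -natr1; nra.
rewrite -EFinD; congr EFin; rewrite /u /i.
have [yh|yh] := boolP (y < 2^-1) => /=.
  rewrite weight_flip ?/admissible ?y01 ?yh// /rho y01 yh invf_div.
  by field; rewrite gt_eqF//; lra.
rewrite /weight /admissible y01 (negbTE yh)/= !add0r /rho y01 (negbTE yh) invrK.
by rewrite mulfV// gt_eqF.
Qed.

End Branches.

(** * Distortion of the weights and contraction of the branches *)

Section Distortion.
Context {R : realType}.
Implicit Types (y z : R) (b : branch_index).

(** The weights are quotients [X / (Y * Z)]; their distortion factor is the
    product of the factors of [X], [Y] and [Z]. *)
Lemma ratio_le (X X' Y Y' Z Z' u v w k : R) :
  0 <= X' -> 0 < Y -> 0 < Y' -> 0 < Z -> 0 < Z' ->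
  0 <= u -> 0 <= v -> 0 <= w ->
  X <= u * X' -> Y' <= v * Y -> Z' <= w * Z -> u * v * w <= k ->
  X / (Y * Z) <= k * (X' / (Y' * Z')).
Proof.
move=> X'0 Y0 Y'0 Z0 Z'0 u0 v0 w0 XX YY ZZ uvw.
rewrite ler_pdivrMr ?mulr_gt0// (le_trans XX)//.
apply: (@le_trans _ _ (u * v * w * X' * (Y * Z) / (Y' * Z'))); last first.
  rewrite [leRHS](_ : _ = k * X' * (Y * Z) / (Y' * Z')); last by ring.
  rewrite ler_pM2r ?invr_gt0 ?mulr_gt0//.
  by rewrite ler_pM2r ?mulr_gt0// ler_wpM2r.
rewrite ler_pdivlMr ?mulr_gt0//.
have : Y' * Z' <= v * Y * (w * Z) by apply: ler_pM => //; exact: ltW.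
move=> /(ler_wpM2l (mulr_ge0 u0 X'0)) h; apply: (le_trans h).
by rewrite le_eqVlt; apply/orP; left; apply/eqP; ring.
Qed.

Lemma weight_flip_distortion y z : admissible None y -> 0 < z < 2^-1 ->
  weight None y <= (1 + `|y - z|) * weight None z.
Proof.
move=> a z0; have az : admissible None z by rewrite /admissible; lra.
rewrite !weight_flip//; case/andP: z0 => z0 zh; case/andP: a => /andP[y0 y1] yh.
have [zy|yz] := leP z y; first by rewrite ger0_norm ?subr_ge0//; nra.
by rewrite ltr0_norm ?subr_lt0// opprB; nra.
Qed.

(** The weight decreases on the lower half, so the factor is 1 for [z <= y].
    For [y < z], with [d = z - y], the numerator [1 - y ^+ 2] loses a factor
    [1 + 4/3 d], and each affine denominator a factor [1 + d], since [m >= 1];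
    the product is at most [1 + 6 d] for [d <= 1/2]. *)
Lemma weight_even_distortion p y z : 0 < y < 2^-1 -> 0 < z < 2^-1 ->
  weight (Some p) y <= (1 + 6 * `|y - z|) * weight (Some p) z.
Proof.
case: p => m n y0 z0.
have [adm|nadm] := boolP (admissible (Some (m, n)) y); last first.
  by rewrite {1}/weight (negbTE nadm) mulr_ge0 ?weight_ge0// addr_ge0 ?mulr_ge0.
have az : admissible (Some (m, n)) z.
  case/andP: adm; rewrite /admissible; case: m => [_|m _ _]; first lra.
  by rewrite andbT; lra.
have m1 : 1 <= m%:R :> R.
  by case/andP: adm => _; case: m {az} => [|m _]; [lra|rewrite ler1n].
rewrite !weight_SomeE// /step_mass /rho.
have /andP[-> _] := adm; have /andP[-> _] := az.
case/andP: y0 => y0 yh; case/andP: z0 => z0 zh; rewrite yh zh !invf_div.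
have n0 : 0 <= n%:R :> R by [].
have den (a t : R) : 0 <= a -> 1 <= t -> 0 < a * t + 1 by nra.
rewrite [leLHS](_ : _ = (1 - y ^+ 2) /
  (((2 * n%:R + 1) * (m%:R + y) + 1) * ((2 * n%:R + 3) * (m%:R + y) + 1))); last first.
  by field; rewrite !gt_eqF// den//; lra.
rewrite [X in _ <= _ * X](_ : _ = (1 - z ^+ 2) /
  (((2 * n%:R + 1) * (m%:R + z) + 1) * ((2 * n%:R + 3) * (m%:R + z) + 1))); last first.
  by field; rewrite !gt_eqF// den//; lra.
have [zy|yz] := leP z y.
  have d : 0 <= y - z by lra.
  rewrite ger0_norm//.
  apply: (@ratio_le _ _ _ _ _ _ 1 1 1).
  - by nra.
  - by apply: den; lra.
  - by apply: den; lra.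
  - by apply: den; lra.
  - by apply: den; lra.
  - by lra.
  - by lra.
  - by lra.
  - by nra.
  - by rewrite mul1r lerD2r ler_wpM2l//; lra.
  - by rewrite mul1r lerD2r ler_wpM2l//; lra.
  - by lra.
rewrite ltr0_norm ?subr_lt0// opprB.
have lin (a : R) : 0 <= a -> a * (m%:R + z) + 1 <=
    (1 + (z - y)) * (a * (m%:R + y) + 1).
  move=> a0; have : 0 <= a * (z - y) * (m%:R + y - 1).
    by rewrite !mulr_ge0//; lra.
  by nra.
apply: (@ratio_le _ _ _ _ _ _ (1 + 4 / 3 * (z - y)) (1 + (z - y)) (1 + (z - y))).
- by nra.
- by apply: den; lra.
- by apply: den; lra.
- by apply: den; lra.
- by apply: den; lra.
- by lra.
- by lra.
- by lra.
- have : 0 <= (z - y) * (1 - y - z) by rewrite mulr_ge0//; lra.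
  have : 0 <= (z - y) * (4^-1 - z ^+ 2) by rewrite mulr_ge0//; [lra|nra].
  by nra.
- by apply: lin; lra.
- by apply: lin; lra.
- have d0 : 0 <= z - y by lra.
  have d1 : z - y <= 2^-1 by lra.
  by move: d0 d1; set d := z - y; nra.
Qed.

(** For [z <= y] only the numerator [2 y] grows, by a factor
    [y / z <= 1 + 2 (y - z)] as [z >= 1/2]. For [y < z] the two denominators
    lose a factor [z / y] each, and the numerator recovers one of them, which
    leaves [z / y <= 1 + 2 (z - y)]. *)
Lemma weight_upper_distortion b y z : 2^-1 <= y < 1 -> 2^-1 <= z < 1 ->
  weight b y <= (1 + 2 * `|y - z|) * weight b z.
Proof.
move=> y1 z1.
have [adm|nadm] := boolP (admissible b y); last first.
  by rewrite {1}/weight (negbTE nadm) mulr_ge0 ?weight_ge0// addr_ge0 ?mulr_ge0.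
case: b adm => [[m n]|/andP[_]]; last by lra.
move=> adm.
have az : admissible (Some (m, n)) z.
  by rewrite /admissible; case: m {adm} => [|m]; lra.
rewrite !weight_SomeE// /step_mass /rho.
have /andP[-> _] := adm; have /andP[-> _] := az.
rewrite !ltNge; case/andP: y1 => yh y1; case/andP: z1 => zh z1.
rewrite yh zh /= !invrK.
have n0 : 0 <= n%:R :> R by [].
have m0 : 0 <= m%:R :> R by [].
have den (a t : R) : 0 <= a -> 0 <= t -> 0 < a * t + 1 by nra.
rewrite [leLHS](_ : _ = (2 * y) /
  (((2 * n%:R + 1) * (m%:R + y) + 1) * ((2 * n%:R + 3) * (m%:R + y) + 1))); last first.
  by field; rewrite !gt_eqF// den//; lra.
rewrite [X in _ <= _ * X](_ : _ = (2 * z) /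
  (((2 * n%:R + 1) * (m%:R + z) + 1) * ((2 * n%:R + 3) * (m%:R + z) + 1))); last first.
  by field; rewrite !gt_eqF// den//; lra.
have [zy|yz] := leP z y.
  have d : 0 <= y - z by lra.
  rewrite ger0_norm//.
  apply: (@ratio_le _ _ _ _ _ _ (1 + 2 * (y - z)) 1 1).
  - by nra.
  - by apply: den; lra.
  - by apply: den; lra.
  - by apply: den; lra.
  - by apply: den; lra.
  - by lra.
  - by lra.
  - by lra.
  - by nra.
  - by rewrite mul1r lerD2r ler_wpM2l//; lra.
  - by rewrite mul1r lerD2r ler_wpM2l//; lra.
  - by lra.
have y0 : 0 < y by lra.
rewrite ltr0_norm ?subr_lt0// opprB.
have lin (a : R) : 0 <= a -> a * (m%:R + z) + 1 <=
    (z / y) * (a * (m%:R + y) + 1).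
  move=> a0; rewrite mulrAC ler_pdivlMr//.
  have : 0 <= a * m%:R * (z - y) by rewrite !mulr_ge0//; lra.
  by nra.
apply: (@ratio_le _ _ _ _ _ _ (y / z) (z / y) (z / y)).
- by nra.
- by apply: den; lra.
- by apply: den; lra.
- by apply: den; lra.
- by apply: den; lra.
- by rewrite divr_ge0//; lra.
- by rewrite divr_ge0//; lra.
- by rewrite divr_ge0//; lra.
- by rewrite mulrCA divfK// gt_eqF//; lra.
- by apply: lin; lra.
- by apply: lin; lra.
- rewrite [leLHS](_ : _ = z / y); last by field; rewrite !gt_eqF//; lra.
  by rewrite ler_pdivrMr//; nra.
Qed.

Lemma branch_SomeB m n y z : 0 <= y -> 0 <= z ->
  branch (Some (m, n)) y - branch (Some (m, n)) z =
  (y - z) / ((2 * n.+1%:R * (m%:R + y) + 1) * (2 * n.+1%:R * (m%:R + z) + 1)).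
Proof.
move=> y0 z0 /=; have D := branch_den_gt0 m n y0; have D' := branch_den_gt0 m n z0.
move: D D'; rewrite -natr1 => D D'.
by field; apply/andP; split; rewrite gt_eqF//; lra.
Qed.

(** On the lower half every branch but the flip has [m + y >= 1], on the upper
    half [m + y >= 1/2]; the derivatives are [(2 N (m + y) + 1)^-2]. *)
Lemma branch_contraction_lower p y z : admissible (Some p) y ->
  0 < y < 2^-1 -> 0 < z < 2^-1 ->
  `|branch (Some p) y - branch (Some p) z| <= `|y - z| / 9.
Proof.
case: p => m n adm /andP[y0 yh] /andP[z0 zh].
have m1 : 1 <= m%:R :> R.
  by case/andP: adm => _; case: m => [|m _]; [lra|rewrite ler1n].
rewrite branch_SomeB; [|exact: ltW..].
rewrite normrM ler_wpM2l// normfV.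
have n0 : 0 <= n%:R :> R by [].
have D x : 0 < x -> 3 <= 2 * n.+1%:R * (m%:R + x) + 1 :> R.
  by move=> x0; rewrite -natr1; nra.
have q : 9 <= (2 * n.+1%:R * (m%:R + y) + 1) * (2 * n.+1%:R * (m%:R + z) + 1) :> R.
  by have := D _ y0; have := D _ z0; nra.
have q0 := lt_le_trans (ltr0n R 9) q.
by rewrite gtr0_norm// lef_pV2 ?posrE.
Qed.

Lemma branch_contraction_upper p y z : 2^-1 <= y -> 2^-1 <= z ->
  `|branch (Some p) y - branch (Some p) z| <= `|y - z| / 4.
Proof.
case: p => m n yh zh; have y0 : 0 < y by lra.
have z0 : 0 < z by lra.
rewrite branch_SomeB; [|exact: ltW..].
rewrite normrM ler_wpM2l// normfV.
have n0 : 0 <= n%:R :> R by [].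
have m0 : 0 <= m%:R :> R by [].
have D x : 2^-1 <= x -> 2 <= 2 * n.+1%:R * (m%:R + x) + 1 :> R.
  by move=> xh; rewrite -natr1; nra.
have q : 4 <= (2 * n.+1%:R * (m%:R + y) + 1) * (2 * n.+1%:R * (m%:R + z) + 1) :> R.
  by have := D _ yh; have := D _ zh; nra.
have q0 := lt_le_trans (ltr0n R 4) q.
by rewrite gtr0_norm// lef_pV2 ?posrE.
Qed.

(** The branch [a_1 = 2, a_2 = 1] is available from every point, with a
    probability bounded below, and its image has length 1/15. *)
Definition common_branch : branch_index := Some (1, 0)%N.

Lemma common_branch_admissible y : 0 < y < 1 -> admissible common_branch y.
Proof. by move=> y01; rewrite /admissible y01. Qed.

Lemma weight_common_branch y : 0 < y < 1 -> 24^-1 <= weight common_branch y.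
Proof.
move=> y01; rewrite weight_SomeE ?common_branch_admissible// /step_mass /rho y01.
case/andP: y01 => y0 y1; case: ifPn => yh.
  rewrite [leRHS](_ : _ = (1 - y ^+ 2) / ((y + 2) * (3 * y + 4))); last first.
    by field; rewrite !gt_eqF//; nra.
  by rewrite ler_pdivlMr; nra.
rewrite -leNgt in yh.
rewrite [leRHS](_ : _ = 2 * y / ((y + 2) * (3 * y + 4))); last first.
  by field; rewrite !gt_eqF//; nra.
by rewrite ler_pdivlMr; nra.
Qed.

Lemma common_branch_close y z : 0 < y < 1 -> 0 < z < 1 ->
  `|branch common_branch y - branch common_branch z| <= 15^-1.
Proof.
move=> /andP[y0 y1] /andP[z0 z1].
have im (x : R) : 0 < x -> x < 1 -> 3^-1 <= branch common_branch x <= 2 / 5.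
  move=> x0 x1; rewrite /= mulr1 ler_pdivlMr ?ler_pdivrMr; [|lra..].
  by apply/andP; split; lra.
have /andP[? ?] := im _ y0 y1; have /andP[? ?] := im _ z0 z1.
by rewrite ler_norml; apply/andP; split; lra.
Qed.

End Distortion.

(** * The transfer operator *)

Section Transfer.
Context {R : realType}.
Implicit Types (y z M A : R) (b : branch_index) (f : R -> R)
  (F : branch_index -> R -> R).

(** The densities may depend on the branch: a cylinder of rank [s + 1] is
    split along its last digit into parts that carry different densities. *)
Definition transfer F y : \bar R :=
  (\esum_(b in [set: branch_index]) (weight b y * F b (branch b y))%:E)%E.

Definition transferR F y : R := fine (transfer F y).

(** The least [A] is a seminorm of [f]. The weights 10 and 5 are tuned to the
    flip, an isometry from the lower half onto the upper half: it costs the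
    Lipschitz constant [5 A] where [10 A] is allowed, and the branches that
    start in the upper half contract by 4, enough to come back from [10 A] to
    [5 A]. *)
Definition regular A f : Prop :=
  [/\ forall y z, 0 < y < 1 -> 0 < z < 1 -> f y <= f z + A,
      forall y z, 0 < y < 2^-1 -> 0 < z < 2^-1 ->
        f y <= f z + 10 * A * `|y - z| &
      forall y z, 2^-1 <= y < 1 -> 2^-1 <= z < 1 ->
        f y <= f z + 5 * A * `|y - z| ].

(** A bound on the Lipschitz constant of the logarithm of [f] on each half.
    The pair [(16, 10) = (p, q)] solves [p = 1 + q + q / 2] and
    [q = 2 + p / 4 + p / 4], the equations that the flip and the upper half
    impose for [transfer_distorted] to hold with the same constants. *)
Definition distorted f : Prop :=
  (forall y z, 0 < y < 2^-1 -> 0 < z < 2^-1 ->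
     f y <= (1 + 16 * `|y - z|) * f z) /\
  (forall y z, 2^-1 <= y < 1 -> 2^-1 <= z < 1 ->
     f y <= (1 + 10 * `|y - z|) * f z).

Lemma weight_out b y : ~~ (0 < y < 1) -> weight b y = 0.
Proof. by move=> y01; rewrite /weight /admissible (negbTE y01). Qed.

Section Bounded.
Context F M (F0 : forall b y, 0 <= F b y <= M).

Let term_ge0 b y : 0 <= weight b y * F b (branch b y).
Proof. by rewrite mulr_ge0 ?weight_ge0//; have /andP[] := F0 b (branch b y). Qed.

Let M0 : 0 <= M.
Proof. by have /andP[/le_trans h /h] := F0 None 0. Qed.

Lemma transfer_ge0 y : (0 <= transfer F y)%E.
Proof. by apply: esum_ge0 => b _; rewrite lee_fin. Qed.

Lemma transfer_le_bound y : (transfer F y <= M%:E)%E.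
Proof.
have [y01|y01] := boolP (0 < y < 1); last first.
  by rewrite /transfer esum1 ?lee_fin// => b _; rewrite weight_out// mul0r.
rewrite -[leRHS]mule1 -(sum_weight y01) -esumZl//; last first.
  by move=> b; rewrite lee_fin weight_ge0.
apply: le_esum => b _; rewrite -EFinM lee_fin mulrC ler_wpM2r ?weight_ge0//.
by have /andP[] := F0 b (branch b y).
Qed.

Lemma transferRE y : (transferR F y)%:E = transfer F y.
Proof.
rewrite fineK// ge0_fin_numE ?transfer_ge0//.
exact: le_lt_trans (transfer_le_bound y) (ltry _).
Qed.

Lemma transferR_bound y : 0 <= transferR F y <= M.
Proof. by rewrite -!lee_fin transferRE transfer_ge0 transfer_le_bound. Qed.

(** Each term of the sum is a weight times a density, so its distortion is
    the product of [1 + c d] for the weight and [1 + l d] for the density,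
    where [l] benefits from the contraction of the branch. With [d <= 1/2]
    this product is at most [1 + 16 d] on the lower half ([c = 1], [l = 10]
    for the flip; [c = 6], [l = 16/9] for the other branches) and [1 + 10 d]
    on the upper half ([c = 2], [l = 16/4]). *)
Lemma transfer_distorted : (forall b, distorted (F b)) -> distorted (transferR F).
Proof.
move=> dF.
have comp k y z : 0 <= k ->
    (forall b, admissible b y -> weight b y * F b (branch b y) <=
      (1 + k) * (weight b z * F b (branch b z))) ->
    transferR F y <= (1 + k) * transferR F z.
  move=> k0 h; rewrite -lee_fin EFinM !transferRE /transfer.
  rewrite -esumZl; [|by move=> b; rewrite lee_fin|by rewrite addr_ge0].
  apply: le_esum => b _; rewrite -EFinM lee_fin.
  have [a|a] := boolP (admissible b y); first exact: h.
  by rewrite {1}/weight (negbTE a) mul0r mulr_ge0// addr_ge0.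
have chain (w w' f f' c l k : R) : 0 <= w' -> 0 <= c -> 0 <= f -> 0 <= f' ->
    w <= (1 + c) * w' -> f <= (1 + l) * f' -> (1 + c) * (1 + l) <= 1 + k ->
    w * f <= (1 + k) * (w' * f').
  move=> w0 c0 f0 f'0 ww ff cl.
  apply: (@le_trans _ _ ((1 + c) * w' * ((1 + l) * f'))).
    apply: (@le_trans _ _ ((1 + c) * w' * f)); first by rewrite ler_wpM2r.
    by rewrite ler_wpM2l// mulr_ge0// addr_ge0.
  by rewrite mulrACA ler_wpM2r// mulr_ge0.
split=> y z y0 z0; apply: comp; rewrite ?mulr_ge0// => b a;
  have /andP[Fy _] := F0 b (branch b y); have /andP[Fz _] := F0 b (branch b z).
- have d2 : `|y - z| <= 2^-1 by rewrite ler_norml; apply/andP; split; lra.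
  have d0 := normr_ge0 (y - z).
  case: b a Fy Fz => [p|] a Fy Fz.
    have [y01 z01] : 0 < y /\ 0 < z by lra.
    have by' := branch_Some_itv p y01; have bz := branch_Some_itv p z01.
    apply: (chain _ _ _ _ (6 * `|y - z|) (16 * (`|y - z| / 9)));
      rewrite ?weight_ge0 ?mulr_ge0//.
    + exact: weight_even_distortion.
    + apply: le_trans ((dF _).1 _ _ by' bz) _; rewrite ler_wpM2r// lerD2l ler_wpM2l//.
      exact: branch_contraction_lower.
    + by nra.
  have az : admissible None z by rewrite /admissible; lra.
  have by' := branch_flip_itv a; have bz := branch_flip_itv az.
  apply: (chain _ _ _ _ (`|y - z|) (10 * `|y - z|)); rewrite ?weight_ge0//.
  + exact: weight_flip_distortion.
  + have -> : `|y - z| = `|branch None y - branch None z|.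
      by rewrite /= opprD addrACA subrr add0r opprK distrC addrC.
    by apply: (dF _).2; lra.
  + by nra.
- have d2 : `|y - z| <= 2^-1 by rewrite ler_norml; apply/andP; split; lra.
  have d0 := normr_ge0 (y - z).
  case: b a Fy Fz => [p|/andP[_]] a Fy Fz; last by lra.
  have [y01 z01] : 0 < y /\ 0 < z by lra.
  have by' := branch_Some_itv p y01; have bz := branch_Some_itv p z01.
  apply: (chain _ _ _ _ (2 * `|y - z|) (16 * (`|y - z| / 4)));
    rewrite ?weight_ge0 ?mulr_ge0//.
  + exact: weight_upper_distortion.
  + apply: le_trans ((dF _).1 _ _ by' bz) _; rewrite ler_wpM2r// lerD2l ler_wpM2l//.
    by apply: branch_contraction_upper; lra.
  + by nra.
Qed.

End Bounded.

Lemma transferR_cst1 y : 0 < y < 1 -> transferR (fun=> cst 1) y = 1.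
Proof.
move=> y01; rewrite /transferR /transfer.
by under eq_esum do rewrite mulr1; rewrite sum_weight.
Qed.

Section Contraction.
Context f M (f0 : forall y, 0 <= f y <= M).
Let F : branch_index -> R -> R := fun=> f.
Let F0 b y : 0 <= F b y <= M := f0 y.

(** The weights at [y] and at [z] both sum to 1, so constants can be spread
    over the branches, and two values of the transfer operator can be compared
    term by term; [e] is a gain on the single branch [b0]. *)
Lemma transferR_compare y z c k c' (e : R) b0 : 0 < y < 1 -> 0 < z < 1 ->
  0 <= c -> 0 <= k -> 0 <= c' -> 0 <= e ->
  (forall b, weight b y * f (branch b y) + c * weight b z +
             (if b == b0 then e else 0) <=
             weight b z * f (branch b z) + k * weight b z + c' * weight b y) ->
  transferR F y + c + e <= transferR F z + k + c'.
Proof.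
move=> y01 z01 c0 k0 c'0 e0 h.
have W (x : R) : 0 < x < 1 -> forall a : R, 0 <= a ->
    (\esum_(b in [set: branch_index]) (a * weight b x)%:E = a%:E)%E.
  move=> x01 a a0; rewrite -[RHS]mule1 -(sum_weight x01) -esumZl//.
  by move=> b; rewrite lee_fin weight_ge0.
rewrite -lee_fin !EFinD !(transferRE F0) -(W _ z01 _ c0) -(W _ z01 _ k0) -(W _ y01 _ c'0).
rewrite -(esum_point b0 (_ : (0 <= e%:E)%E))// /transfer.
have p0 b (x : R) : (0 <= (weight b x * F b (branch b x))%:E)%E.
  by rewrite lee_fin mulr_ge0 ?weight_ge0//; have /andP[] := f0 (branch b x).
have w0 (a : R) b (x : R) : 0 <= a -> (0 <= (a * weight b x)%:E)%E.
  by move=> a0; rewrite lee_fin mulr_ge0 ?weight_ge0.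
have e1 b : (0 <= (if b == b0 then e%:E else 0))%E by case: ifP.
rewrite -!esumD; try by move=> *; rewrite ?adde_ge0 ?w0 ?p0 ?e1.
apply: le_esum => b _; rewrite -!EFinD.
by have := h b; case: ifP => _; rewrite -?EFinD lee_fin.
Qed.

(** Let [c] be the infimum of [f], so that [c <= f <= c + A].

    Oscillation: replace [f] by [c + A] above [y] and by [c] above [z]. On the
    common branch the two values differ by at most [10 A / 15], so at least
    [A / 3] is gained there, on a mass of at least [1/24]: the oscillation is
    at most [(1 - 1/72) A].

    Lipschitz constants, with [d] the distance of [y] to [z]: a distortion
    [1 + C d] of the weights contributes [C A d], because [f - c <= A], and
    the variation of [f] along the branch contributes the rest. On the lower
    half the total is [(1 + 5) A d] for the flip and [(6 + 10/9) A d] for the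
    other branches, below [10 * 71/72 A d]; on the upper half it is
    [(2 + 10/4) A d], below [5 * 71/72 A d]. *)
Lemma regular_transfer A : 0 <= A -> regular A f ->
  regular (71 / 72 * A) (transferR F).
Proof.
move=> A0 [fo fl fu].
pose S := [set f y | y in [set y | 0 < y < 1]]; pose c := inf S.
have S0 : S !=set0 by exists (f 2^-1), 2^-1 => //=; lra.
have lbS : lbound S 0 by move=> _ [y _ <-]; have /andP[] := f0 y.
have c0 : 0 <= c by exact: lb_le_inf.
have fc y : 0 < y < 1 -> c <= f y.
  by move=> y01; apply: ge_inf; [exists 0|exists y].
have fcA y : 0 < y < 1 -> f y <= c + A.
  move=> y01; rewrite -lerBlDr; apply: lb_le_inf => // _ [z z01 <-].
  by rewrite lerBlDr fo.
have bd b y : admissible b y -> c <= f (branch b y) <= c + A.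
  by move=> /branch_itv b01; rewrite fc// fcA.
have term (y z C l k : R) b : 0 <= C ->
    weight b y <= (1 + C) * weight b z ->
    (admissible b y -> admissible b z) ->
    (admissible b y -> f (branch b y) <= f (branch b z) + l) ->
    0 <= l -> C * A + l <= k ->
    weight b y * f (branch b y) + c * weight b z <=
    weight b z * f (branch b z) + k * weight b z + c * weight b y.
  move=> C0 wC az fb l0 CAl.
  have wz0 := weight_ge0 b z; have wy0 := weight_ge0 b y.
  have [a|a] := boolP (admissible b y); last first.
    rewrite /weight (negbTE a) mul0r mulr0 add0r addr0 -/(weight b z).
    have [a'|a'] := boolP (admissible b z); last first.
      by rewrite /weight (negbTE a') !mulr0 mul0r addr0.
    have /andP[h _] := bd _ _ a'; have k0 : 0 <= k.
      by rewrite (le_trans _ CAl)// addr_ge0// mulr_ge0.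
    by nra.
  have /andP[h1 h2] := bd _ _ a; have h3 := fb a.
  have p1 : 0 <= ((1 + C) * weight b z - weight b y) * (f (branch b y) - c).
    by rewrite mulr_ge0 ?subr_ge0.
  have p2 : 0 <= weight b z * (f (branch b z) + l - f (branch b y)).
    by rewrite mulr_ge0 ?subr_ge0.
  have p3 : 0 <= weight b z * (k - C * A - l) by rewrite mulr_ge0//; lra.
  have p4 : 0 <= weight b z * (C * (c + A - f (branch b y))).
    by rewrite mulr_ge0// mulr_ge0// subr_ge0.
  by nra.
split=> y z y0 z0.
- pose e := 24^-1 * (A / 3).
  suff : transferR F y + c + e <= transferR F z + 0 + (c + A).
    by rewrite /e; lra.
  apply: (@transferR_compare y z c 0 (c + A) e common_branch) => //.
  + by rewrite addr_ge0.
  + by rewrite /e mulr_ge0// divr_ge0.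
  move=> b; rewrite mul0r addr0.
  have wz0 := weight_ge0 b z; have wy0 := weight_ge0 b y.
  have hy : weight b y * f (branch b y) <= weight b y * (c + A).
    have [a|a] := boolP (admissible b y); last by rewrite /weight (negbTE a) !mul0r.
    by rewrite ler_wpM2l//; have /andP[] := bd _ _ a.
  have hz : weight b z * c <= weight b z * f (branch b z).
    have [a|a] := boolP (admissible b z); last by rewrite /weight (negbTE a) !mul0r.
    by rewrite ler_wpM2l//; have /andP[] := bd _ _ a.
  case: eqP => [bE|_]; last by lra.
  have ay := common_branch_admissible y0; have az := common_branch_admissible z0.
  have /andP[i1 i2] := bd _ _ ay; have /andP[i3 i4] := bd _ _ az.
  have wy := weight_common_branch y0; have wz := weight_common_branch z0.
  have cl : f (branch common_branch y) <= f (branch common_branch z) + 2 / 3 * A.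
    have h := branch_Some_itv (1, 0)%N.
    have /andP[y01 _] := y0; have /andP[z01 _] := z0.
    apply: le_trans (fl _ _ (h _ _ y01) (h _ _ z01)) _; rewrite lerD2l.
    have := common_branch_close y0 z0.
    by rewrite -/common_branch; set d := `|_|; nra.
  rewrite -bE in i1 i2 i3 i4 wy wz cl.
  have q1 : 0 <= (weight b y - 24^-1) * (c + A - f (branch b y)).
    by rewrite mulr_ge0 ?subr_ge0.
  have q2 : 0 <= (weight b z - 24^-1) * (f (branch b z) - c).
    by rewrite mulr_ge0 ?subr_ge0.
  by rewrite /e; nra.
- have d2 : `|y - z| <= 2^-1 by rewrite ler_norml; apply/andP; split; lra.
  have d0 := normr_ge0 (y - z).
  have [y01 z01] : 0 < y /\ 0 < z by lra.
  suff : transferR F y + c + 0 <=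
      transferR F z + 10 * (71 / 72 * A) * `|y - z| + c by lra.
  apply: (@transferR_compare _ _ _ _ _ _ None) => //; rewrite ?mulr_ge0//; try lra.
  move=> b; rewrite if_same addr0.
  case: b => [p|].
    have by' := branch_Some_itv p y01; have bz := branch_Some_itv p z01.
    apply: (term _ _ (6 * `|y - z|) (10 * A * (`|y - z| / 9))); rewrite ?mulr_ge0//.
    + exact: weight_even_distortion.
    + rewrite /admissible; case: p {by' bz} => [[|m] n]; lra.
    + move=> a; apply: le_trans (fl _ _ by' bz) _.
      rewrite lerD2l ler_wpM2l ?mulr_ge0//; exact: branch_contraction_lower.
    + by nra.
  have ay : admissible None y by rewrite /admissible; lra.
  have az : admissible None z by rewrite /admissible; lra.
  have by' := branch_flip_itv ay; have bz := branch_flip_itv az.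
  apply: (term _ _ (`|y - z|) (5 * A * `|y - z|)); rewrite ?mulr_ge0//.
  + exact: weight_flip_distortion.
  + have -> : `|y - z| = `|branch None y - branch None z|.
      by rewrite /= opprD addrACA subrr add0r opprK distrC addrC.
    by move=> _; apply: fu; lra.
  + by nra.
- have d2 : `|y - z| <= 2^-1 by rewrite ler_norml; apply/andP; split; lra.
  have d0 := normr_ge0 (y - z).
  have [y01 z01] : 0 < y /\ 0 < z by lra.
  suff : transferR F y + c + 0 <=
      transferR F z + 5 * (71 / 72 * A) * `|y - z| + c by lra.
  apply: (@transferR_compare _ _ _ _ _ _ None) => //; rewrite ?mulr_ge0//; try lra.
  move=> b; rewrite if_same addr0.
  apply: (term _ _ (2 * `|y - z|) (10 * A * (`|y - z| / 4))); rewrite ?mulr_ge0//.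
  + exact: weight_upper_distortion.
  + rewrite /admissible; case: b => [[[|m] n]|]; lra.
  + case: b => [p|/andP[_]] a; last by lra.
    have by' := branch_Some_itv p y01; have bz := branch_Some_itv p z01.
    apply: le_trans (fl _ _ by' bz) _.
    by rewrite lerD2l ler_wpM2l ?mulr_ge0//; apply: branch_contraction_upper; lra.
  + by nra.
Qed.

End Contraction.
End Transfer.

(** * Measures with a density *)

Section Density.
Context {d} {T : measurableType d} {R : realType}.
Context (mu : {sigma_finite_measure set T -> \bar R}) (j : T -> R)
  (mj : measurable_fun setT j) (j0 : forall x, 0 <= j x)
  (jfin : (\int[mu]_x (j x)%:E < +oo)%E).
Local Open Scope ereal_scope.

(** The hypotheses on [j] are arguments so that the measure instances below
    apply without further data. *)
Definition density_measure of measurable_fun setT j & (forall x, 0 <= j x)%R &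
  \int[mu]_x (j x)%:E < +oo : set T -> \bar R :=
  fun A => \int[mu]_(x in A) (j x)%:E.

Local Notation nu := (density_measure mj j0 jfin).

Let mj' : measurable_fun setT (EFin \o j).
Proof. exact/measurable_EFinP. Qed.

Let j0' x : 0 <= (EFin \o j) x. Proof. by rewrite lee_fin. Qed.

Let nu0 : nu set0 = 0.
Proof. by rewrite /density_measure integral_set0. Qed.

Let nu_ge0 A : 0 <= nu A.
Proof. by apply: integral_ge0 => x _; rewrite lee_fin. Qed.

HB.instance Definition _ := isMeasure.Build _ _ _ nu nu0 nu_ge0
  (semi_sigma_additive_nng_induced mj' j0').

Let nu_fin : fin_num_fun nu.
Proof.
move=> A mA; rewrite ge0_fin_numE//; apply: le_lt_trans jfin.
apply: (@ge0_subset_integral _ _ _ mu A setT mA) => // x _; exact: j0'.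
Qed.

HB.instance Definition _ := Measure_isFinite.Build _ _ _ nu nu_fin.

Lemma integral_density D (f : T -> \bar R) : measurable D ->
  (forall x, 0 <= f x) -> measurable_fun D f ->
  \int[nu]_(x in D) f x = \int[mu]_(x in D) (f x * (j x)%:E).
Proof.
move=> mD f0 mf.
have nuE A : measurable A -> nu A = \int[mu]_(x in A) (j x)%:E by [].
have numu : nu `<< mu.
  apply/null_content_dominatesP => A mA A0.
  rewrite nuE//; apply: null_set_integral => //; exact: measurable_funTS.
rewrite -(Radon_Nikodym_SigmaFinite.change_of_variables numu)//.
apply: ae_eq_integral => //.
- apply: emeasurable_funM => //; apply: measurable_funTS.
  exact: measurable_int (Radon_Nikodym_SigmaFinite.f_integrable numu).
- by apply: emeasurable_funM => //; exact: measurable_funTS.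
apply: ae_eqe_mul2l; apply: integral_ae_eq => //.
- apply: (integrableS measurableT) => //.
  exact: Radon_Nikodym_SigmaFinite.f_integrable.
- exact: measurable_funTS.
- by move=> A _ mA; rewrite -Radon_Nikodym_SigmaFinite.f_integral.
Qed.

End Density.

(** * Integration on the real line *)

Section RealTools.
Context {R : realType}.
Notation leb := (@lebesgue_measure R).

(** Written as [x * (x ^+ 2)^-1], the inverse becomes a real power of a
    nonnegative number, so the pole needs no separate treatment. *)
Lemma measurable_invr : measurable_fun setT (@GRing.inv R).
Proof.
rewrite (_ : GRing.inv = fun x : R => x * (x ^+ 2) `^ (-1)).
  apply: measurable_funM => //.
  have h := measurableT_comp (measurable_powR (-1)) (@exprn_measurable R setT 2).
  exact: h.
apply/funext => x; rewrite powR_inv1 ?sqr_ge0//.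
have [->|x0] := eqVneq x 0; first by rewrite mul0r invr0.
by rewrite expr2 invfM mulrA mulfV// mul1r.
Qed.

Lemma finite_measure_unique (m1 m2 : {measure set (measurableTypeR R) -> \bar R}) :
  (m1 setT < +oo)%E ->
  (forall a b : R, a < b -> m1 `]a, b]%classic = m2 `]a, b]%classic) ->
  forall A, measurable A -> m1 A = m2 A.
Proof.
move=> fin1 m12.
pose g (n : nat) : set (measurableTypeR R) := `](- n%:R), n%:R]%classic.
apply: (@measure_unique _ R (measurableTypeR R) (@ocitv R) g erefl (@ocitvI R)).
- by move=> n; exists (- n%:R, n%:R).
- apply/seteqP; split=> // x _; exists (Num.truncn `|x|).+1 => //.
  rewrite /g /= in_itv /=; have := truncnS_gt `|x|.
  by rewrite ltr_norml => /andP[-> h]; exact: ltW.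
- move=> _ [[a b] _ <-] /=; have [ab|ba] := ltP a b; first exact: m12.
  by rewrite set_itv_ge ?measure0// bnd_simp -leNgt.
- move=> n; apply: le_lt_trans fin1; apply: le_measure; rewrite ?inE//.
  exact: measurable_itv.
Qed.

Lemma lebesgue_measure_between (p q : R) (A : set (measurableTypeR R)) :
  measurable A -> p <= q -> `]p, q[ `<=` A -> A `<=` `[p, q] ->
  leb A = (q - p)%:E.
Proof.
move=> mA pq pA Aq.
have L (b0 b1 : bool) : leb [set` Interval (BSide b0 p) (BSide b1 q)] = (q - p)%:E.
  rewrite lebesgue_measure_itv/= lte_fin; have [pq'|qp] := ltP p q.
    by rewrite EFinB.
  by have -> : p = q by [apply/eqP; rewrite eq_le pq]; rewrite subrr.
apply/eqP; rewrite eq_le -{1}(L true false) -(L false true).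
by rewrite !le_measure ?inE//; exact: measurable_itv.
Qed.

(** The end points do not matter for an integral over an interval, but the
    range of a branch may or may not contain them. *)
Lemma ge0_integral_between (p q : R) (A : set (measurableTypeR R)) (f : R -> \bar R) :
  measurable A -> `]p, q[ `<=` A -> A `<=` `[p, q] ->
  measurable_fun setT f -> (forall x, (0 <= f x)%E) ->
  (\int[leb]_(x in A) f x = \int[leb]_(x in `[p, q]) f x)%E.
Proof.
move=> mA pA Aq mf f0; apply/eqP; rewrite eq_le; apply/andP; split.
  by apply: ge0_subset_integral => //; exact: measurable_funTS.
rewrite integral_itv_bndoo; last exact: measurable_funTS.
by apply: ge0_subset_integral => //; exact: measurable_funTS.
Qed.

Lemma integral_derivative (f F : R -> R) (a b : R) : a <= b ->
  (forall x, a <= x <= b -> is_derive x 1 F (f x)) ->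
  (forall x, a <= x <= b -> {for x, continuous f}) ->
  (\int[leb]_(x in `[a, b]) (f x)%:E = (F b - F a)%:E)%E.
Proof.
rewrite le_eqVlt => /predU1P[<- _ _|ab dF cf].
  by rewrite set_itv1 integral_set1 subrr.
have cF x : a <= x <= b -> {for x, continuous F}.
  move=> /dF dFx; apply/differentiable_continuous/derivable1_diffP.
  exact: ex_derive.
rewrite (@continuous_FTC2 _ f F)//.
- apply: continuous_in_subspaceT => x; rewrite inE/= in_itv/=; exact: cf.
- split.
  + move=> x; rewrite in_itv/= => /andP[ax xb]; have := dF x.
    by rewrite !ltW// => /(_ isT) ?; exact: ex_derive.
  + by apply: cvg_at_right_filter; apply: cF; rewrite lexx ltW.
  + by apply: cvg_at_left_filter; apply: cF; rewrite lexx ltW.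
- move=> x; rewrite in_itv/= => /andP[ax xb]; have := dF x.
  by rewrite !ltW// => /(_ isT) ?; rewrite derive1E derive_val.
Qed.

(** Change of variables for a function that is only defined on [J]: [psi]
    inverts [G] above [J], and [j], which vanishes off [J], is the density of
    the image of Lebesgue measure under [G]. *)
Lemma ge0_change_of_variables (J : set (measurableTypeR R))
    (G psi j : measurableTypeR R -> measurableTypeR R) :
  measurable_fun setT G -> measurable_fun setT psi -> measurable_fun setT j ->
  measurable J -> (forall y, 0 <= j y) -> (forall y, ~ J y -> j y = 0) ->
  (\int[leb]_y (j y)%:E < +oo)%E -> (forall x, J (G x) -> psi (G x) = x) ->
  (forall a b : R, a < b -> leb (G @^-1` (`]a, b] `&` J)) =
    (\int[leb]_(y in `]a, b]) (j y)%:E)%E) ->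
  forall (F : R -> \bar R) V, (forall x, 0 <= F x)%E ->
    measurable_fun setT F -> measurable V ->
  (\int[leb]_(x in G @^-1` (V `&` J)) F x =
   \int[leb]_(y in V) (F (psi y) * (j y)%:E))%E.
Proof.
move=> mG mpsi mj mJ j0 jJ jfin psiG lebJ F V F0 mF mV.
pose push : {measure set (measurableTypeR R) -> \bar R} :=
  measure_function_pushforward__canonical__measure_function_Measure leb mG.
pose nu := density_measure mj j0 jfin.
have nuE A : measurable A -> nu A = mrestr push mJ A.
  apply: finite_measure_unique; first exact: jfin.
  by move=> a b ab; exact: esym (lebJ a b ab).
have mVJ : measurable (V `&` J) by exact: measurableI.
have mFpsi : measurable_fun setT (F \o psi) by exact: measurableT_comp.
transitivity (\int[leb]_(x in G @^-1` (V `&` J)) ((F \o psi) \o G) x)%E.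
  by apply: eq_integral => x /[!inE] -[_ Jx] /=; rewrite psiG.
rewrite -(ge0_integral_pushforward mG)//; last 2 first.
- exact: measurable_funTS.
- by move=> y _; exact: F0.
transitivity (\int[nu]_(y in V `&` J) (F \o psi) y)%E.
  apply: eq_measure_integral => A mA AVJ; rewrite [RHS]nuE// /mrestr setIidl//.
  by apply: subset_trans AVJ _; exact: subIsetr.
rewrite integral_density//; last 2 first.
- by move=> y; exact: F0.
- exact: measurable_funTS.
rewrite integral_mkcondr; apply: eq_integral => y _ /=.
by rewrite patchE; case: ifPn => //; rewrite notin_setE => /jJ ->; rewrite mule0.
Qed.

End RealTools.

(** * Change of variables along a branch *)

Section BranchSubstitution.
Context {R : realType}.
Notation leb := (@lebesgue_measure R).
Implicit Types (x y z : R) (b : branch_index).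

(** [g] on the cell [b], extended to the line by the same formula. *)
Definition forward b x : R :=
  match b with
  | None => 1 - x
  | Some (m, n) => (x^-1 - 2 * n.+1%:R)^-1 - m%:R
  end.

Lemma branch_forward b x : admissible b (forward b x) ->
  branch b (forward b x) = x.
Proof.
case: b => [[m n] a|_ /=]; last by rewrite subKr.
have t0 : 0 < (x^-1 - 2 * n.+1%:R)^-1.
  case/andP: a => /andP[/= f0 _] _; have : 0 <= m%:R :> R by [].
  by lra.
have u0 : 0 < x^-1 - 2 * n.+1%:R by rewrite -invr_gt0.
rewrite /= addrC subrK; set u := x^-1 - _ in t0 u0 *.
rewrite -[RHS]invrK (_ : x^-1 = 2 * n.+1%:R + u); last by rewrite /u addrC subrK.
have N0 : 0 <= n%:R :> R by [].
by rewrite -natr1; field; rewrite !gt_eqF//; nra.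
Qed.

Lemma measurable_forward b : measurable_fun setT (forward b).
Proof.
case: b => [[m n]|] /=; last exact: measurable_funB.
apply: measurable_funB => //; apply: measurableT_comp => //; first exact: measurable_invr.
by apply: measurable_funB => //; exact: measurable_invr.
Qed.

Lemma measurable_branch b : measurable_fun setT (@branch R b).
Proof.
case: b => [[m n]|] /=; last exact: measurable_funB.
apply: measurable_funM; first exact: measurable_funD.
apply: measurableT_comp => //; first exact: measurable_invr.
apply: measurable_funD => //; apply: measurable_funM => //.
exact: measurable_funD.
Qed.

Lemma measurable_branch_slope b : measurable_fun setT (@branch_slope R b).
Proof.
case: b => [[m n]|] /=; last exact: measurable_cst.
apply: measurableT_comp => //; first exact: measurable_invr.
apply: measurable_funX; apply: measurable_funD => //; apply: measurable_funM => //.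
exact: measurable_funD.
Qed.

Definition range_lo b : R := if b is Some (0, _)%N then 2^-1 else 0.
Definition range_hi b : R := if b is None then 2^-1 else 1.

Lemma admissible_range b y : admissible b y -> range_lo b <= y <= range_hi b.
Proof.
by case: b => [[[|m] n]|] /andP[/andP[y0 y1]] /=; rewrite /range_lo/=; lra.
Qed.

Lemma range_admissible b y : range_lo b < y < range_hi b -> admissible b y.
Proof.
by rewrite /admissible /range_lo /range_hi; case: b => [[[|m] n]|] /=; lra.
Qed.

Lemma range_bounds b : 0 <= range_lo b /\ range_hi b <= 1.
Proof. by rewrite /range_lo /range_hi; case: b => [[[|m] n]|]; split; lra. Qed.

Lemma measurable_admissible b :
  measurable ([set y | admissible b y] : set (measurableTypeR R)).
Proof.
case: b => [[[|m] n]|].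
- rewrite (_ : [set y | _] = `[2^-1, 1[%classic); first exact: measurable_itv.
  by apply/seteqP; split=> y; rewrite /= in_itv /admissible/=; lra.
- rewrite (_ : [set y | _] = `]0, 1[%classic); first exact: measurable_itv.
  by apply/seteqP; split=> y; rewrite /= in_itv /admissible/=; lra.
- rewrite (_ : [set y | _] = `]0, 2^-1[%classic); first exact: measurable_itv.
  by apply/seteqP; split=> y; rewrite /= in_itv /admissible/=; lra.
Qed.

Definition image_density b y : R := if admissible b y then branch_slope b y else 0.

Lemma measurable_image_density b : measurable_fun setT (image_density b).
Proof.
apply: measurable_fun_ifT => //; last exact: measurable_branch_slope.
apply: (measurable_fun_bool true).
by rewrite setTI; exact: measurable_admissible.
Qed.

Lemma image_density_ge0 b y : 0 <= image_density b y.
Proof. by rewrite /image_density; case: ifP => // _; exact: branch_slope_ge0. Qed.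

Lemma branch_slope_le1 b y : 0 < y -> branch_slope b y <= 1.
Proof.
case: b => [[m n]|]//= y0; have D := branch_den_gt0 m n (ltW y0).
rewrite invf_le1 ?exprn_gt0// exprn_ege1// lerDr ?mulr_ge0// addr_ge0// ltW//.
Qed.

Lemma image_density_fin b : (\int[leb]_y (image_density b y)%:E < +oo)%E.
Proof.
apply: (@le_lt_trans _ _ (\int[leb]_(y in `]0%R, 1%R[) 1)%E); last first.
  by rewrite integral_cst//= lebesgue_measure_itv/= lte_fin ltr01 -EFinB mul1e ltry.
rewrite [leRHS]integral_mkcond; apply: ge0_le_integral => //.
- by move=> y _; rewrite lee_fin image_density_ge0.
- by apply/measurable_EFinP; exact: measurable_image_density.
- by apply/(measurable_restrictT _ _).1 => //; exact: measurable_itv.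
move=> y _; rewrite /image_density patchE.
case: ifPn => [/admissible01 y01|_]; last by case: ifP.
by rewrite mem_set/= ?in_itv//= lee_fin branch_slope_le1//; case/andP: y01.
Qed.

Lemma is_derive_branch m n y : 0 <= y ->
  is_derive y 1 (branch (Some (m, n))) (branch_slope (Some (m, n)) y).
Proof.
move=> y0; pose c : R := 2 * n.+1%:R.
have D : 0 < c * (m%:R + y) + 1 by rewrite ltr_wpDl// mulr_ge0 ?addr_ge0 ?mulr_ge0.
have d1 : is_derive y 1 (cst m%:R + id) (1 : R).
  by apply: is_derive_eq; rewrite add0r.
have d2 : is_derive y 1 (c *: (cst m%:R + id) + cst 1) c.
  by apply: is_derive_eq; rewrite addr0 scaler1.
have Dn : (c *: (cst m%:R + id) + cst 1 : R -> R) y != 0.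
  by rewrite gt_eqF.
have d3 := is_deriveV Dn d2.
have d4 := is_deriveM d1 d3.
apply: (@is_derive_eq _ _ _ _ _ _ _ _ d4).
have E : (c *: (cst m%:R + id) + cst 1 : R -> R) y = c * (m%:R + y) + 1 by [].
rewrite !E /= -/c.
rewrite [(_ + id) y](_ : _ = m%:R + y)// /GRing.scale/= mulr1.
by field; rewrite gt_eqF.
Qed.

Lemma branch_slope_continuous m n y : 0 <= y ->
  {for y, continuous (@branch_slope R (Some (m, n)))}.
Proof.
move=> y0 /=; have D : 0 < 2 * n.+1%:R * (m%:R + y) + 1 :> R.
  by rewrite ltr_wpDl// mulr_ge0 ?addr_ge0 ?mulr_ge0.
apply: cvgV; first by rewrite expf_neq0// gt_eqF.
have h : (2 * n.+1%:R * (m%:R + x) + 1) @[x --> y] --> 2 * n.+1%:R * (m%:R + y) + 1.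
  apply: cvgD; last exact: cvg_cst.
  by apply: cvgM; [exact: cvg_cst|apply: cvgD; [exact: cvg_cst|exact: cvg_id]].
exact: (cvgM h h).
Qed.

Lemma branch_mono m n y z : 0 <= y -> 0 <= z ->
  (branch (Some (m, n)) y < branch (Some (m, n)) z) = (y < z).
Proof.
move=> y0 z0; rewrite -subr_gt0 branch_SomeB// pmulr_lgt0 ?subr_gt0//.
by rewrite invr_gt0 mulr_gt0// branch_den_gt0.
Qed.

(** A branch is monotone, so the image of an interval is an interval, whose
    length is the integral of the absolute value of the derivative. For a
    Moebius map of determinant 1 or -1 the latter is the inverse square of the
    denominator, that is [branch_slope]. *)
Lemma lebesgue_forward_preimage b (c d : R) : c < d ->
  leb (forward b @^-1` (`]c, d] `&` [set y | admissible b y])) =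
  (\int[leb]_(y in `]c, d]) (image_density b y)%:E)%E.
Proof.
move=> cd; set A := _ `&` _.
have mA : measurable A by apply: measurableI; [exact: measurable_itv|exact: measurable_admissible].
have mfA : measurable (forward b @^-1` A).
  by rewrite -[X in measurable X]setTI; exact: measurable_forward.
have -> : (\int[leb]_(y in `]c, d]) (image_density b y)%:E =
    \int[leb]_(y in A) (branch_slope b y)%:E)%E.
  rewrite integral_mkcondr; apply: eq_integral => y _.
  rewrite patchE /image_density; case: ifPn => h; first by rewrite mem_set.
  by rewrite memNset//=; exact/negP.
(* The set of admissible points of [c < y <= d] lies between the open and the
   closed interval with end points [l] and [r]. *)
pose l := Num.max c (range_lo b); pose r := Num.min d (range_hi b).
have [lo0 hi1] := range_bounds b.
have Alr y : A y -> l <= y <= r.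
  move=> [/=]; rewrite in_itv/= => /andP[cy yd] /admissible_range/andP[ly yr].
  by rewrite /l /r ge_max le_min yd yr ly (ltW cy).
have lrA y : l < y < r -> A y.
  rewrite /l /r gt_max lt_min => /andP[/andP[cy ly] /andP[yd yr]].
  split; first by rewrite /= in_itv/= cy ltW.
  by apply: range_admissible; rewrite ly.
have lr0 : 0 <= l by rewrite /l le_max lo0 orbT.
have r1 : r <= 1 by rewrite /r ge_min hi1 orbT.
have [rl|lr] := ltP r l.
  have A0 : A = set0.
    by apply/seteqP; split=> // y /Alr/andP[/le_trans h /h]; rewrite leNgt rl.
  by rewrite A0 preimage_set0 measure0 integral_set0.
rewrite (@ge0_integral_between _ l r)//; last 2 first.
- by apply/measurable_EFinP; exact: measurable_branch_slope.
- by move=> y; rewrite lee_fin branch_slope_ge0.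
case: b l r lo0 hi1 @A mA mfA Alr lrA lr0 r1 lr => [[m n]|] l r lo0 hi1 A mA mfA Alr lrA l0 r1 lr.
- have -> : (\int[leb]_(y in `[l, r]) (branch_slope (Some (m, n)) y)%:E =
      (branch (Some (m, n)) r - branch (Some (m, n)) l)%:E)%E.
    apply: integral_derivative => //.
    by move=> y /andP[ly _]; apply: is_derive_branch; exact: le_trans ly.
    by move=> y /andP[ly _]; apply: branch_slope_continuous; exact: le_trans ly.
  have r0 := le_trans l0 lr.
  have den y : 0 <= y -> 0 < 2 * n.+1%:R * (m%:R + y) + 1 by exact: branch_den_gt0.
  have N0 : 0 < 2 * n.+1%:R :> R by rewrite mulr_gt0.
  have m0 : 0 <= m%:R :> R by [].
  apply: lebesgue_measure_between => //.
  + by move: lr; rewrite le_eqVlt => /predU1P[->//|lr]; rewrite ltW// branch_mono.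
  + move=> x; rewrite /= in_itv => /andP[lx xr]; apply: lrA.
    have x0 : 0 < x by apply: le_lt_trans lx; apply: divr_ge0;
      [exact: addr_ge0|exact: ltW (den _ l0)].
    have Nx : 2 * n.+1%:R * x < 1.
      apply: (@lt_trans _ _ (2 * n.+1%:R * branch (Some (m, n)) r)).
        by rewrite ltr_pM2l.
      by rewrite /= mulrA ltr_pdivrMr ?den// mul1r ltrDl.
    have u0 : 0 < x^-1 - 2 * n.+1%:R by rewrite subr_gt0 -[ltRHS]mul1r ltr_pdivlMr.
    set t := (_ - _)^-1; have t0 : 0 < t by rewrite invr_gt0.
    have Dt : 0 < 2 * n.+1%:R * t + 1 by rewrite ltr_wpDl// ltW// mulr_gt0.
    have xE : x = t / (2 * n.+1%:R * t + 1).
      rewrite -[LHS]invrK (_ : x^-1 = t^-1 + 2 * n.+1%:R); last by rewrite invrK subrK.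
      rewrite [RHS](_ : _ = (t^-1 + 2 * n.+1%:R)^-1)//.
      move: (2 * n.+1%:R) Dt {N0 Nx u0 xr lx den} => N Dt.
      by field; rewrite !gt_eqF//; lra.
    have h1 : (m%:R + l) * (2 * n.+1%:R * t + 1) < t * (2 * n.+1%:R * (m%:R + l) + 1).
      by rewrite -ltr_pdivlMr// -mulrAC -ltr_pdivrMr ?den// -xE.
    have h2 : t * (2 * n.+1%:R * (m%:R + r) + 1) < (m%:R + r) * (2 * n.+1%:R * t + 1).
      by rewrite -ltr_pdivlMr ?den// -mulrAC -ltr_pdivrMr// -xE.
    rewrite ltrBrDl ltrBlDl -/t.
    by apply/andP; split; nra.
  + move=> x Ax; have /andP[lf fr] := Alr _ Ax.
    have xE := branch_forward (proj2 Ax).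
    change (is_true (x \in `[branch (Some (m, n)) l, branch (Some (m, n)) r])).
    rewrite in_itv -xE; change (is_true (branch (Some (m, n)) l <=
      branch (Some (m, n)) (forward (Some (m, n)) x) <= branch (Some (m, n)) r)).
    have f0 := le_trans l0 lf.
    apply/andP; split.
      by move: lf; rewrite le_eqVlt => /predU1P[<-//|?]; rewrite ltW// branch_mono.
    by move: fr; rewrite le_eqVlt => /predU1P[->//|?]; rewrite ltW// branch_mono.
- have -> : (\int[leb]_(y in `[l, r]) (branch_slope None y)%:E =
      \int[leb]_(y in `[l, r]) cst 1 y)%E by [].
  rewrite integral_cst//= lebesgue_measure_itv/= lte_fin mul1e.
  rewrite (@lebesgue_measure_between _ (1 - r) (1 - l))//.
  + move: lr; rewrite le_eqVlt => /predU1P[->|->]; last by rewrite -EFinB; congr EFin; lra.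
    by rewrite ltxx subrr.
  + lra.
  + move=> x; rewrite /= in_itv/= => ?; apply: lrA; lra.
  + by move=> x /Alr; rewrite /= in_itv/=; lra.
Qed.

Lemma ge0_branch_substitution b (F : R -> \bar R) V :
  (forall x, 0 <= F x)%E -> measurable_fun setT F -> measurable V ->
  (\int[leb]_(x in forward b @^-1` (V `&` [set y | admissible b y])) F x =
   \int[leb]_(y in V) (F (branch b y) * (image_density b y)%:E))%E.
Proof.
move=> F0 mF mV; apply: ge0_change_of_variables => //.
- exact: measurable_forward.
- exact: measurable_branch.
- exact: measurable_image_density.
- exact: measurable_admissible.
- by move=> y; exact: image_density_ge0.
- by move=> y /negP a; rewrite /image_density (negbTE a).
- exact: image_density_fin.
- by move=> x; exact: branch_forward.
- by move=> c d; exact: lebesgue_forward_preimage.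
Qed.

End BranchSubstitution.

(** * The map [g] and its branches *)

Section Coding.
Context {R : realType}.
Notation leb := (@lebesgue_measure R).
Implicit Types (x y theta : R) (b : branch_index) (V : set (measurableTypeR R)).

Definition branch_of theta : branch_index :=
  let a := cf_digit1 theta in
  if a == 1%N then None
  else Some (if odd a then 0%N else cf_digit1 (gauss theta), a./2.-1).

Lemma branch_of_spec theta : irr01 theta ->
  forward (branch_of theta) theta = g theta /\ admissible (branch_of theta) (g theta).
Proof.
move=> it; have [a0 ig tE] := irr01_cf it.
have [/andP[t0 t1] _] := it; have [/andP[g0 g1] _] := ig.
have vE : theta^-1 = (cf_digit1 theta)%:R + gauss theta by rewrite [in LHS]tE invrK.
rewrite /branch_of /g; have [a1|a1] := eqVneq (cf_digit1 theta) 1%N.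
  split=> //; rewrite /admissible.
  rewrite a1 in vE; have : theta * theta^-1 = 1 by rewrite mulfV ?gt_eqF.
  by rewrite vE => ?; nra.
have a2 : (0 < (cf_digit1 theta)./2)%N.
  by move: a0 a1; case: (cf_digit1 theta) => [|[|?]].
have aE : (cf_digit1 theta)%:R = (odd (cf_digit1 theta))%:R +
    2 * (cf_digit1 theta)./2.-1.+1%:R :> R.
  by rewrite prednK// -natrM -natrD mul2n odd_double_half.
case: ifPn => ao; rewrite /forward vE aE ?ao ?(negbTE ao) /=.
  rewrite subr0 (_ : _ - _ = 1 + gauss theta); last by rewrite addrAC addrK.
  split=> //; rewrite /admissible.
  have i0 : 0 < 1 + gauss theta by lra.
  rewrite invr_gt0 i0 invf_lt1// lef_pV2 ?posrE//; lra.
rewrite add0r addrAC subrr add0r; split=> //.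
have [m0 igg _] := irr01_cf ig.
by have [h _] := igg; rewrite /admissible h; case: (cf_digit1 _) m0.
Qed.

(** The cells are disjoint on irrational numbers: the end points that two
    neighbouring cells may share, such as [y = 1/2], come from rational
    numbers. *)
Lemma admissible_branch_of b theta : irr01 theta ->
  admissible b (forward b theta) -> branch_of theta = b.
Proof.
move=> [/andP[t0 t1] it]; set y := forward b theta => a.
have tE : branch b y = theta by exact: branch_forward.
have /andP[y0 y1] := admissible01 a; rewrite /branch_of /cf_digit1.
case: b @y a tE y0 y1 => [[m n]|] y a tE y0 y1; last first.
  have /andP[h _] := branch_flip_itv a; rewrite tE in h.
  rewrite (@truncn_def _ _ 1)//.
  have v0 : 0 < theta^-1 by rewrite invr_gt0.
  have : theta * theta^-1 = 1 by rewrite mulfV ?gt_eqF.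
  by move=> ?; apply/andP; split; nra.
have my : 0 < m%:R + y by rewrite ltr_wpDl.
have vE : theta^-1 = (2 * n.+1)%:R + (m%:R + y)^-1.
  rewrite -tE /= natrM; have := branch_den_gt0 m n (ltW y0).
  move: (n.+1%:R) => N D; rewrite invf_div mulrDl mul1r mulfK// gt_eqF//.
case: m @y a tE y0 y1 my vE => [|m] y a tE y0 y1 my vE.
  rewrite add0r in vE.
  have yh : 2^-1 < y.
    rewrite lt_neqAle; case/andP: a => _ ->; rewrite andbT.
    apply/eqP => yE; apply: it; exists (2 * n.+1 + 2)%:R^-1 => //.
    by rewrite fmorphV/= rmorph_nat natrD -[X in _ + X]invrK yE -vE invrK.
  have vy : 1 < y^-1 < 2.
    by rewrite invf_gt1// y1/= -[ltRHS]invrK ltf_pV2 ?posrE.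
  have -> : Num.truncn theta^-1 = (2 * n.+1).+1.
    apply: truncn_def; rewrite vE -!natr1; lra.
  by rewrite mul2n [odd _]/= odd_double -uphalfE uphalf_double.
have vy : 0 < (m.+1%:R + y)^-1 < 1.
  have m1 : 1 <= m.+1%:R :> R by rewrite ler1n.
  by rewrite invr_gt0 my invf_lt1//; lra.
have tr : Num.truncn theta^-1 = (2 * n.+1)%N.
  by apply: truncn_def; rewrite vE -[ltRHS]natr1; lra.
rewrite /gauss /cf_digit1 tr vE addrAC subrr add0r mul2n [_ == 1%N]/= odd_double doubleK.
rewrite invrK (@truncn_def _ _ m.+1)//.
by apply/andP; split; rewrite -?natr1; lra.
Qed.

Lemma countable_rational : countable (@rational R).
Proof. exact: card_le_trans (card_image_le _ _) (countableP _). Qed.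

Lemma measurable_rational : measurable (@rational R).
Proof.
apply: countable_measurable => [t|]; first exact: measurable_set1.
exact: countable_rational.
Qed.

Lemma measurable_irr01 : measurable (@irr01 R).
Proof.
rewrite (_ : @irr01 R = `]0, 1[%classic `&` ~` (@rational R)).
  apply: measurableI; first exact: measurable_itv.
  by apply: measurableC; exact: measurable_rational.
by apply/seteqP; split=> x; rewrite /irr01 /= in_itv.
Qed.

Lemma lebesgue_irr01C : leb (`]0, 1[ `\` @irr01 R) = 0.
Proof.
apply/eqP; rewrite eq_le measure_ge0 andbT.
have rat0 : leb (@rational R) = 0.
  exact/countable_lebesgue_measure0/countable_rational.
rewrite -rat0; apply: le_measure; rewrite ?inE.
- by apply: measurableD; [exact: measurable_itv|exact: measurable_irr01].
- exact: measurable_rational.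
- by move=> x [/=]; rewrite in_itv/= => x01 nx; apply: contrapT => rx; apply: nx.
Qed.

Lemma g_preimage_bigcup V : g_preimage V =
  \bigcup_b (@irr01 R `&` forward b @^-1` (V `&` [set y | admissible b y])).
Proof.
apply/seteqP; split=> x.
  move=> [ix Vx]; exists (branch_of x) => //; have [fE a] := branch_of_spec ix.
  by split=> //; rewrite /preimage /= fE.
move=> [b _ [ix [Vx a]]]; split => //.
have [fE _] := branch_of_spec ix.
by rewrite /preimage /= -fE (admissible_branch_of ix a).
Qed.

Lemma trivIset_forward V : trivIset [set: branch_index]
  (fun b => @irr01 R `&` forward b @^-1` (V `&` [set y | admissible b y])).
Proof.
move=> b b' _ _ [x [[ix [_ a]] [_ [_ a']]]].
by rewrite -(admissible_branch_of ix a) (admissible_branch_of ix a').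
Qed.

Lemma measurable_forward_preimage b V : measurable V ->
  measurable (@irr01 R `&` forward b @^-1` (V `&` [set y | admissible b y])).
Proof.
move=> mV; apply: measurableI; first exact: measurable_irr01.
rewrite -[X in measurable X]setTI; apply: measurable_forward => //.
by apply: measurableI => //; exact: measurable_admissible.
Qed.

Lemma measurable_g_preimage V : measurable V -> measurable (g_preimage V).
Proof.
move=> mV; rewrite g_preimage_bigcup; apply: bigcup_countType_measurable => b.
exact: measurable_forward_preimage.
Qed.

End Coding.

(** * Duality between the map and the transfer operator *)

Section Duality.
Context {R : realType}.
Notation leb := (@lebesgue_measure R).
Implicit Types (x y : R) (b : branch_index) (V : set (measurableTypeR R))
  (f : R -> R) (F : branch_index -> R -> R).

Lemma measurable_rho : measurable_fun setT (@rho R).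
Proof.
apply: measurable_fun_ifT => //.
- by apply: measurable_and; apply: measurable_fun_ltr.
apply: measurable_fun_ifT => //; first exact: measurable_fun_ltr.
- apply: measurable_funM => //; apply: measurableT_comp => //; first exact: measurable_invr.
  by apply: measurable_funB => //; exact: exprn_measurable.
- exact: measurable_invr.
Qed.

Lemma measurable_weight b : measurable_fun setT (@weight R b).
Proof.
apply: measurable_fun_ifT => //.
  apply: (measurable_fun_bool true).
  by rewrite setTI; exact: measurable_admissible.
apply: measurable_funM; last first.
  by apply: measurableT_comp; [exact: measurable_invr|exact: measurable_rho].
apply: measurable_funM; last exact: measurable_branch_slope.
by apply: measurableT_comp; [exact: measurable_rho|exact: measurable_branch].
Qed.

Definition rho_int f V : \bar R := (\int[leb]_(x in V) (f x * rho x)%:E)%E.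

Lemma measurable_mulr_rho f : measurable_fun setT f ->
  measurable_fun setT (fun x => (f x * rho x)%:E).
Proof.
by move=> mf; apply/measurable_EFinP; apply: measurable_funM => //; exact: measurable_rho.
Qed.

(** [rho] vanishes off the unit interval, in which the rational numbers form
    a null set. *)
Lemma rho_int_irr01 f V : measurable V -> measurable_fun setT f ->
  (forall x, 0 <= f x) -> rho_int f (@irr01 R `&` V) = rho_int f V.
Proof.
move=> mV mf f0.
have mN : measurable (`]0, 1[ `\` @irr01 R : set (measurableTypeR R)).
  by apply: measurableD; [exact: measurable_itv|exact: measurable_irr01].
have f0' x : (0 <= (f x * rho x)%:E)%E by rewrite lee_fin mulr_ge0 ?rho_ge0.
rewrite {2}/rho_int (ge0_negligible_integral mN mV)//; last 2 first.
- by apply: measurable_funTS; exact: measurable_mulr_rho.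
- exact: lebesgue_irr01C.
rewrite /rho_int setIC integral_mkcondr setDE [RHS]integral_mkcondr.
apply: eq_integral => x Vx; rewrite !patchE.
have [ix|ix] := boolP (x \in @irr01 R).
  by rewrite mem_set// => -[_]; apply; rewrite -in_setE.
case: ifPn => //; rewrite inE => nN; rewrite /rho; case: ifP; last by rewrite mulr0.
move=> x01; exfalso; apply: nN; split; first by rewrite /= in_itv.
by move=> /mem_set; exact/negP.
Qed.

Lemma measurable_transferR F M : (forall b y, 0 <= F b y <= M) ->
  (forall b, measurable_fun setT (F b)) -> measurable_fun setT (transferR F).
Proof.
move=> F0 mF; apply: measurableT_comp; first exact: fine_measurable.
apply: measurable_fun_esum => // [b|b x]; last first.
  by rewrite lee_fin mulr_ge0 ?weight_ge0//; have /andP[] := F0 b (branch b x).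
apply/measurable_EFinP; apply: measurable_funM; first exact: measurable_weight.
by apply: measurableT_comp; [exact: mF|exact: measurable_branch].
Qed.

Lemma rho_int_ge0 f V : (forall x, 0 <= f x) -> (0 <= rho_int f V)%E.
Proof. by move=> f0; apply: integral_ge0 => x _; rewrite lee_fin mulr_ge0 ?rho_ge0. Qed.

(** Change of variables on each branch: by the definition of [weight], the
    density [F b * rho] on the cell [b] becomes the term [b] of
    [transferR F], times [rho]. *)
Lemma esum_rho_int F M V : (forall b y, 0 <= F b y <= M) ->
  (forall b, measurable_fun setT (F b)) -> measurable V ->
  (\esum_(b in [set: branch_index]) rho_int (F b) (@irr01 R `&`
     forward b @^-1` (V `&` [set y | admissible b y])) =
   rho_int (transferR F) V)%E.
Proof.
move=> F0 mF mV.
have F0' b y : 0 <= F b y by have /andP[] := F0 b y.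
transitivity (\esum_(b in [set: branch_index])
    \int[leb]_(y in V) (weight b y * F b (branch b y) * rho y)%:E)%E.
  apply: eq_esum => b _; rewrite rho_int_irr01//; last first.
    rewrite -[X in measurable X]setTI; apply: measurable_forward => //.
    by apply: measurableI => //; exact: measurable_admissible.
  rewrite /rho_int (ge0_branch_substitution b)//.
  - apply: eq_integral => y _; rewrite -EFinM; congr EFin.
    rewrite -[RHS]mulrAC weight_rho /image_density.
    by case: ifP => _; rewrite ?mul0r ?mulr0//; ring.
  - by move=> x; rewrite lee_fin mulr_ge0 ?rho_ge0.
  - exact: measurable_mulr_rho.
rewrite -ge0_integral_esum//.
- apply: eq_integral => y _; rewrite mulrC EFinM (transferRE F0) /transfer -esumZl ?rho_ge0//.
    by apply: eq_esum => b _; rewrite -EFinM mulrC.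
  by move=> b; rewrite lee_fin mulr_ge0 ?weight_ge0.
- move=> b; apply: measurable_funTS; apply: measurable_mulr_rho.
  apply: measurable_funM; first exact: measurable_weight.
  by apply: measurableT_comp; [exact: mF|exact: measurable_branch].
- by move=> b y; rewrite lee_fin !mulr_ge0 ?weight_ge0 ?rho_ge0.
Qed.

Lemma rho_int_g_preimage f M V : (forall x, 0 <= f x <= M) ->
  measurable_fun setT f -> measurable V ->
  rho_int f (g_preimage V) = rho_int (transferR (fun=> f)) V.
Proof.
move=> f0 mf mV; rewrite -(@esum_rho_int _ M)// /rho_int g_preimage_bigcup.
rewrite (ge0_integral_bigcup_esum _ _ _ _)//.
- by move=> b; exact: measurable_forward_preimage.
- exact: measurable_mulr_rho.
- by move=> x; rewrite lee_fin mulr_ge0 ?rho_ge0//; have /andP[] := f0 x.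
- exact: trivIset_forward.
Qed.

Lemma rho_int_eq f f' V : measurable V -> (forall x, 0 < x < 1 -> f x = f' x) ->
  rho_int f V = rho_int f' V.
Proof.
move=> mV ff; apply: eq_integral => x _; congr EFin.
by rewrite /rho; case: ifP => [/ff->|]; rewrite ?mulr0.
Qed.

Lemma rho_int_invariant V : measurable V ->
  rho_int (cst 1) (g_preimage V) = rho_int (cst 1) V.
Proof.
move=> mV; rewrite (@rho_int_g_preimage _ 1)//; last by move=> x /=; rewrite ler01 lexx.
by apply: rho_int_eq => // x x01; rewrite transferR_cst1.
Qed.

End Duality.

(** * Decay of correlations for regular densities *)

Section Mixing.
Context {R : realType}.
Notation leb := (@lebesgue_measure R).
Implicit Types (x y M A c : R) (V : set (measurableTypeR R)) (f : R -> R).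

Definition bounded_mfun M f := measurable_fun setT f /\ forall x, 0 <= f x <= M.

Lemma bounded_mfun_cst M c : 0 <= c <= M -> bounded_mfun M (cst c).
Proof. by move=> cM; split => //; exact: measurable_cst. Qed.

Lemma bounded_mfun_transfer M f : bounded_mfun M f -> bounded_mfun M (transferR (fun=> f)).
Proof.
move=> [mf f0]; split; first exact: (@measurable_transferR _ _ M).
by move=> x; exact: transferR_bound.
Qed.

Definition transfer_iter j f : R -> R := iter j (fun h => transferR (fun=> h)) f.

Lemma bounded_mfun_transfer_iter M j f : bounded_mfun M f -> bounded_mfun M (transfer_iter j f).
Proof. by move=> tf; elim: j => // j ih /=; exact: bounded_mfun_transfer. Qed.

Lemma regular_transfer_iter M A j f : 0 <= A -> bounded_mfun M f -> regular A f ->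
  regular ((71 / 72) ^+ j * A) (transfer_iter j f).
Proof.
move=> A0 tf rf; elim: j => [|j ih] /=; first by rewrite expr0 mul1r.
have [_ h0] := bounded_mfun_transfer_iter j tf.
have B0 : 0 <= (71 / 72) ^+ j * A by rewrite mulr_ge0// exprn_ge0// divr_ge0.
rewrite exprS -mulrA; exact: (regular_transfer h0 B0 ih).
Qed.

Lemma measurable_iter_g_preimage j V : measurable V ->
  measurable (iter j (@g_preimage R) V).
Proof. by move=> mV; elim: j => //= j; exact: measurable_g_preimage. Qed.

Lemma rho_int_iter M j f V : bounded_mfun M f -> measurable V ->
  rho_int f (iter j (@g_preimage R) V) = rho_int (transfer_iter j f) V.
Proof.
move=> tf mV; elim: j f tf => // j ih f tf.
rewrite iterS (@rho_int_g_preimage _ _ M); [|exact: tf.2|exact: tf.1|].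
  by rewrite ih ?/transfer_iter -?iterSr//; exact: bounded_mfun_transfer.
exact: measurable_iter_g_preimage.
Qed.

Lemma iter_g_preimageP j V x : irr01 x ->
  iter j (@g_preimage R) V x <-> V (iter j (@g R) x).
Proof.
elim: j x => // j ih x ix; rewrite iterS iterSr -(ih _ (irr01_g ix)).
by split=> [[]|].
Qed.

(** The domain of the partial map [g^j] has full measure. *)
Lemma rho_int_iter_setT M j f : bounded_mfun M f ->
  rho_int f (iter j (@g_preimage R) setT) = rho_int f setT.
Proof.
move=> [mf f0]; have f0' x : 0 <= f x by have /andP[] := f0 x.
rewrite -(rho_int_irr01 (V := setT))// -rho_int_irr01//; last first.
  exact: measurable_iter_g_preimage.
congr rho_int; apply/seteqP; split=> x [ix _]; split => //.
exact/(iter_g_preimageP _ _ ix).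
Qed.

Lemma rho_int_cst1_ub V : measurable V -> (rho_int (cst 1%R) V <= (8 / 3)%:E)%E.
Proof.
move=> mV; apply: (@le_trans _ _ (\int[leb]_(x in `]0%R, 1%R[) (8 / 3)%:E)%E); last first.
  by rewrite integral_cst//= lebesgue_measure_itv/= lte_fin ltr01 oppr0 adde0 mule1.
rewrite /rho_int integral_mkcond [leRHS]integral_mkcond; apply: ge0_le_integral => //.
- by move=> x _; rewrite patchE; case: ifP => //; rewrite lee_fin mulr_ge0 ?rho_ge0.
- apply/(measurable_restrictT _ _).1 => //; apply: measurable_funTS.
  exact: measurable_mulr_rho.
- by apply/(measurable_restrictT _ _).1 => //; exact: measurable_itv.
move=> x _; rewrite !patchE.
have [x01|x01] := boolP (0 < x < 1).
  rewrite [in leRHS]mem_set/= ?in_itv//=; have /andP[r1 r2] := rho_itv x01.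
  by case: ifP => _; rewrite lee_fin ?mul1r// divr_ge0.
by rewrite /rho (negbTE x01) mulr0; case: ifP => _; case: ifP => _; rewrite ?lee_fin ?divr_ge0.
Qed.

Lemma rho_int_fin M f V : bounded_mfun M f -> measurable V -> rho_int f V \is a fin_num.
Proof.
move=> [mf f0] mV; have f0' x : 0 <= f x by have /andP[] := f0 x.
rewrite ge0_fin_numE ?rho_int_ge0//.
have M0 : 0 <= M by have /andP[/le_trans h /h] := f0 0.
apply: (@le_lt_trans _ _ (M%:E * rho_int (cst 1%R) V)%E); last first.
  apply: le_lt_trans (ltry (M * (8 / 3))); rewrite EFinM.
  by rewrite lee_wpmul2l ?lee_fin// rho_int_cst1_ub.
rewrite /rho_int -ge0_integralZl//; last 2 first.
- by apply: measurable_funTS; exact: measurable_mulr_rho.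
- by move=> x _; rewrite lee_fin mulr_ge0 ?rho_ge0.
apply: ge0_le_integral => //.
- by move=> x _; rewrite lee_fin mulr_ge0 ?rho_ge0.
- by apply: measurable_funTS; exact: measurable_mulr_rho.
- by apply: measurable_funTS; apply: measurable_funeM; exact: measurable_mulr_rho.
- move=> x _; rewrite -EFinM lee_fin mul1r ler_wpM2r ?rho_ge0//.
  by have /andP[] := f0 x.
Qed.

Definition rho_Rint f V : R := fine (rho_int f V).

Lemma rho_RintE M f V : bounded_mfun M f -> measurable V -> (rho_Rint f V)%:E = rho_int f V.
Proof. by move=> tf mV; rewrite fineK// (rho_int_fin tf). Qed.

Lemma rho_Rint_ge0 f V : (forall x, 0 <= f x) -> 0 <= rho_Rint f V.
Proof. by move=> f0; rewrite fine_ge0// rho_int_ge0. Qed.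

Lemma rho_Rint_le M M' f f' V : bounded_mfun M f -> bounded_mfun M' f' -> measurable V ->
  (forall x, 0 < x < 1 -> V x -> f x <= f' x) -> rho_Rint f V <= rho_Rint f' V.
Proof.
move=> tf tf' mV ff; rewrite -lee_fin (rho_RintE tf)// (rho_RintE tf')//.
apply: ge0_le_integral => //.
- by move=> x _; rewrite lee_fin mulr_ge0 ?rho_ge0//; have /andP[] := tf.2 x.
- by apply: measurable_funTS; apply: measurable_mulr_rho; exact: tf.1.
- by apply: measurable_funTS; apply: measurable_mulr_rho; exact: tf'.1.
move=> x Vx; rewrite lee_fin /rho; case: ifP => x01; last by rewrite !mulr0.
by rewrite ler_wpM2r ?ff//; have := rho_ge0 x; rewrite /rho x01.
Qed.

Lemma rho_Rint_affine M f c V : bounded_mfun M f -> 0 <= c -> measurable V ->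
  rho_Rint (fun x => f x + c) V = rho_Rint f V + c * rho_Rint (cst 1) V.
Proof.
move=> tf c0 mV.
have tc : bounded_mfun (M + c) (fun x => f x + c).
  split; first by apply: measurable_funD => //; exact: tf.1.
  by move=> x; have /andP[f0 fM] := tf.2 x; rewrite addr_ge0//= lerD2r.
have t1 : bounded_mfun 1 (cst 1 : R -> R) by apply: bounded_mfun_cst; rewrite ler01 lexx.
apply: EFin_inj; rewrite EFinD EFinM (rho_RintE tc)// (rho_RintE tf)// (rho_RintE t1)//.
rewrite /rho_int -ge0_integralZl//; last 2 first.
- by apply: measurable_funTS; exact: measurable_mulr_rho.
- by move=> x _; rewrite lee_fin mulr_ge0 ?rho_ge0.
rewrite -ge0_integralD//.
- by apply: eq_integral => x _; rewrite -EFinM -EFinD mul1r mulrDl.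
- by move=> x _; rewrite lee_fin mulr_ge0 ?rho_ge0//; have /andP[] := tf.2 x.
- by apply: measurable_funTS; apply: measurable_mulr_rho; exact: tf.1.
- by move=> x _; rewrite -EFinM lee_fin !mulr_ge0 ?rho_ge0.
- by apply: measurable_funTS; apply: measurable_funeM; exact: measurable_mulr_rho.
Qed.

Lemma rho_Rint_scale M f c V : bounded_mfun M f -> 0 <= c -> measurable V ->
  rho_Rint (fun x => c * f x) V = c * rho_Rint f V.
Proof.
move=> tf c0 mV; have M0 : 0 <= M by have /andP[/le_trans h /h] := tf.2 0.
have tc : bounded_mfun (c * M) (fun x => c * f x).
  split; first by apply: measurable_funM => //; exact: tf.1.
  by move=> x; have /andP[f0 fM] := tf.2 x; rewrite mulr_ge0//= ler_wpM2l.
apply: EFin_inj; rewrite EFinM (rho_RintE tc)// (rho_RintE tf)//.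
rewrite /rho_int -ge0_integralZl//.
- by apply: eq_integral => x _; rewrite -EFinM mulrA.
- by apply: measurable_funTS; apply: measurable_mulr_rho; exact: tf.1.
- by move=> x _; rewrite lee_fin mulr_ge0 ?rho_ge0//; have /andP[] := tf.2 x.
Qed.

Lemma rho_Rint_cst c V : 0 <= c -> measurable V -> rho_Rint (cst c) V = c * rho_Rint (cst 1) V.
Proof.
move=> c0 mV; have t1 : bounded_mfun 1 (cst 1 : R -> R).
  by apply: bounded_mfun_cst; rewrite ler01 lexx.
by rewrite -(rho_Rint_scale t1)//; congr rho_Rint; apply/funext => x /=; rewrite mulr1.
Qed.

Definition total_mass : R := rho_Rint (cst 1) setT.

Lemma total_mass_bounds : 1 <= total_mass <= 8 / 3.
Proof.
have t1 : bounded_mfun 1 (cst 1 : R -> R) by apply: bounded_mfun_cst; rewrite ler01 lexx.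
rewrite -!lee_fin (rho_RintE t1)// rho_int_cst1_ub// andbT.
rewrite (_ : 1%:E = \int[leb]_(x in `]0%R, 1%R[) 1)%E; last first.
  by rewrite integral_cst//= lebesgue_measure_itv/= lte_fin ltr01 oppr0 adde0 mule1.
rewrite integral_mkcond /rho_int; apply: ge0_le_integral => //.
- by move=> x _; rewrite patchE; case: ifP.
- by apply/(measurable_restrictT _ _).1 => //; exact: measurable_itv.
- exact: measurable_mulr_rho.
move=> x _; rewrite patchE mul1r; case: ifPn => [|_]; last by rewrite lee_fin rho_ge0.
by rewrite inE /= in_itv/= => /rho_itv/andP[r1 _]; rewrite lee_fin.
Qed.

(** The mass of [g^-j V] is the integral over [V] of the iterated density [h].
    As [h] oscillates by at most [B], it is within [B] of its mean, and the
    error is at most [B] times the mass of [V]. All the masses are those of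
    [rho dx], whence the factors [total_mass]. *)
Lemma mixing_bound M A j f V : 0 <= A -> bounded_mfun M f -> regular A f -> measurable V ->
  `|rho_Rint f (iter j (@g_preimage R) V) * total_mass - rho_Rint f setT * rho_Rint (cst 1) V| <=
  (71 / 72) ^+ j * A * total_mass * rho_Rint (cst 1) V.
Proof.
move=> A0 tf rf mV.
have th := bounded_mfun_transfer_iter j tf.
have [osc _ _] := regular_transfer_iter j A0 tf rf.
set h := transfer_iter j f in th osc; set B := _ * A in osc *.
have B0 : 0 <= B by rewrite mulr_ge0// exprn_ge0// divr_ge0.
have Z0 : 0 <= total_mass by apply: rho_Rint_ge0 => x /=.
have v0 : 0 <= rho_Rint (cst 1) V by apply: rho_Rint_ge0 => x /=.
have -> : rho_Rint f (iter j (@g_preimage R) V) = rho_Rint h V.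
  by rewrite /rho_Rint (rho_int_iter j tf).
have -> : rho_Rint f setT = rho_Rint h setT.
  by rewrite /rho_Rint -(rho_int_iter_setT j tf) (rho_int_iter j tf).
have tc c : 0 <= c -> bounded_mfun c (cst c) by move=> c0; apply: bounded_mfun_cst; rewrite c0 lexx.
have h0 x : 0 <= h x by have /andP[] := th.2 x.
have tadd k c : bounded_mfun k h -> 0 <= c -> bounded_mfun (k + c) (fun x => h x + c).
  move=> [mh hk] c0; split; first exact: measurable_funD.
  by move=> x; have /andP[? ?] := hk x; rewrite addr_ge0//= lerD2r.
have up y : 0 < y < 1 -> h y * total_mass <= rho_Rint h setT + B * total_mass.
  move=> y01; rewrite -(rho_Rint_affine th)// -(rho_Rint_cst (h0 y))//.
  by apply: (rho_Rint_le (tc _ (h0 y)) (tadd _ _ th B0)) => // z z01 _; exact: osc.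
have lo y : 0 < y < 1 -> rho_Rint h setT <= (h y + B) * total_mass.
  have hB : 0 <= h y + B by rewrite addr_ge0.
  move=> y01; rewrite -(rho_Rint_cst hB)//.
  by apply: (rho_Rint_le th (tc _ hB)) => // z z01 _; exact: osc.
have r0 : 0 <= rho_Rint h setT by exact: rho_Rint_ge0.
have tZ : bounded_mfun (total_mass * M) (fun x => total_mass * h x).
  split; first by apply: measurable_funM => //; exact: th.1.
  by move=> x; have /andP[? ?] := th.2 x; rewrite mulr_ge0//= ler_wpM2l.
have k0 : 0 <= rho_Rint h setT + B * total_mass by rewrite addr_ge0// mulr_ge0.
have q1 : total_mass * rho_Rint h V <= (rho_Rint h setT + B * total_mass) * rho_Rint (cst 1) V.
  rewrite -(rho_Rint_scale th)// -(rho_Rint_cst k0)//.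
  by apply: (rho_Rint_le tZ (tc _ k0)) => // y y01 _; rewrite mulrC; exact: up.
have ZB : 0 <= total_mass * B by rewrite mulr_ge0.
have tZB : bounded_mfun (total_mass * M + total_mass * B)
    (fun x => total_mass * h x + total_mass * B).
  split; first by apply: measurable_funD => //; exact: tZ.1.
  by move=> x; have /andP[? ?] := tZ.2 x; rewrite addr_ge0//= lerD2r.
have q2 : rho_Rint h setT * rho_Rint (cst 1) V <=
    total_mass * rho_Rint h V + total_mass * B * rho_Rint (cst 1) V.
  rewrite -(rho_Rint_scale th)// -(rho_Rint_affine tZ)// -(rho_Rint_cst r0)//.
  by apply: (rho_Rint_le (tc _ r0) tZB) => // y y01 _; rewrite -mulrDr mulrC; exact: lo.
by rewrite ler_norml; apply/andP; split; lra.
Qed.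

End Mixing.

(** * Cylinders *)

Section Cylinders.
Context {R : realType}.
Implicit Types (x y theta : R) (V U : set (measurableTypeR R)) (f : R -> R).

Definition itinerary (s : nat) theta : seq branch_index :=
  mkseq (fun i => branch_of (iter i (@g R) theta)) s.

Lemma itineraryS s theta : itinerary s.+1 theta =
  rcons (itinerary s theta) (branch_of (iter s (@g R) theta)).
Proof. by rewrite /itinerary /mkseq -addn1 iotaD map_cat cats1. Qed.

(** The unions of cylinders of rank [s]: [S] is any set of words, so that this
    family is closed under the operations of a sigma-algebra. *)
Definition itinerary_set s (S : set (seq branch_index)) : set (measurableTypeR R) :=
  [set theta | irr01 theta /\ S (itinerary s theta)].

Lemma iter_irr01 j theta : irr01 theta -> irr01 (iter j (@g R) theta).
Proof. by move=> it; elim: j => //= j; exact: irr01_g. Qed.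

Lemma itinerary_setS s S V : itinerary_set s.+1 S `&` iter s.+1 (@g_preimage R) V =
  \bigcup_b (itinerary_set s [set w | S (rcons w b)] `&` iter s (@g_preimage R)
    (@irr01 R `&` forward b @^-1` (V `&` [set y | admissible b y]))).
Proof.
apply/seteqP; split=> x.
  move=> [[ix Sx]]; rewrite iter_g_preimageP// iterS => Vx.
  have ig := iter_irr01 s ix; have [fE a] := branch_of_spec ig.
  exists (branch_of (iter s (@g R) x)) => //; split.
    by split => //=; rewrite -itineraryS.
  rewrite iter_g_preimageP//; split => //; split; first by rewrite fE.
  by rewrite /= fE.
move=> [b _ [[ix Sx]]]; rewrite iter_g_preimageP// => -[ig [Vf a]].
have ib := admissible_branch_of ig a; have [fE _] := branch_of_spec ig.
split; first by split => //; rewrite itineraryS ib.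
by rewrite iter_g_preimageP// iterS -fE ib.
Qed.

Lemma trivIset_itinerary_set s S V : trivIset [set: branch_index] (fun b =>
  itinerary_set s [set w | S (rcons w b)] `&` iter s (@g_preimage R)
    (@irr01 R `&` forward b @^-1` (V `&` [set y | admissible b y]))).
Proof.
move=> b b' _ _ [x [[[ix _]]]].
rewrite iter_g_preimageP// => -[ig [_ a]] [_].
rewrite iter_g_preimageP// => -[_ [_ a']].
by rewrite -(admissible_branch_of ig a) (admissible_branch_of ig a').
Qed.

Lemma distorted_cst (c : R) : 0 <= c -> distorted (cst c).
Proof.
by move=> c0; split=> y z _ _ /=; rewrite -[leLHS]mul1r ler_wpM2r// lerDl mulr_ge0.
Qed.

(** [f] is the density, relative to [rho dx], of the image by [g^s] of
    [rho dx] restricted to a union of cylinders of rank [s]. Splitting along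
    the last digit, a density of rank [s + 1] is the transfer of a family of
    densities of rank [s], one for each branch, so [transfer_distorted] yields
    distortion constants that do not depend on [s]. *)
Lemma cylinder_density s S : measurable (itinerary_set s S) /\
  exists f, [/\ bounded_mfun 1 f, distorted f & forall V, measurable V ->
    rho_int (cst 1) (itinerary_set s S `&` iter s (@g_preimage R) V) = rho_int f V].
Proof.
elim: s S => [|s ih] S.
  have [S0|S0] := pselect (S [::]).
    have E : itinerary_set 0 S = @irr01 R.
      by apply/seteqP; split=> x; [case|move=> ?; split].
    rewrite E; split; first exact: measurable_irr01.
    exists (cst 1); split; first by apply: bounded_mfun_cst; rewrite ler01 lexx.
      exact: distorted_cst.
    by move=> V mV; rewrite rho_int_irr01.
  have E : itinerary_set 0 S = set0 by apply/seteqP; split=> // x [].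
  rewrite E; split; first exact: measurable0.
  exists (cst 0); split; first by apply: bounded_mfun_cst; rewrite ler01 lexx.
    exact: distorted_cst.
  move=> V mV; rewrite set0I /rho_int integral_set0.
  by under eq_integral do rewrite mul0r; rewrite integral0.
have mD V b : measurable V -> measurable (itinerary_set s [set w | S (rcons w b)] `&`
    iter s (@g_preimage R) (@irr01 R `&` forward b @^-1` (V `&` [set y | admissible b y]))).
  move=> mV; apply: measurableI; first exact: (ih _).1.
  by apply: measurable_iter_g_preimage; exact: measurable_forward_preimage.
split.
  have -> : itinerary_set s.+1 S = itinerary_set s.+1 S `&` iter s.+1 (@g_preimage R) setT.
    apply/seteqP; split=> x; last by case.
    by move=> [ix Sx]; split => //; rewrite iter_g_preimageP.
  by rewrite itinerary_setS; apply: bigcup_countType_measurable => b; exact: mD.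
have /choice[F FP] : forall b, exists f, [/\ bounded_mfun 1 f, distorted f &
  forall V, measurable V ->
    rho_int (cst 1) (itinerary_set s [set w | S (rcons w b)] `&` iter s (@g_preimage R) V)
    = rho_int f V] by move=> b; exact: (ih _).2.
have F0 b y : 0 <= F b y <= 1 by have [[_ h] _ _] := FP b.
have mF b : measurable_fun setT (F b) by have [[h _] _ _] := FP b.
exists (transferR F); split.
- split; first exact: (measurable_transferR F0).
  by move=> x; exact: transferR_bound.
- by apply: (transfer_distorted F0) => b; have [] := FP b.
move=> V mV; rewrite itinerary_setS -(esum_rho_int F0)//.
rewrite {1}/rho_int ge0_integral_bigcup_esum.
- apply: eq_esum => b _; have [_ _ <-//] := FP b.
  exact: measurable_forward_preimage.
- by move=> b; exact: mD.
- exact: measurable_mulr_rho.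
- by move=> x; rewrite lee_fin mulr_ge0 ?rho_ge0.
- exact: trivIset_itinerary_set.
Qed.

(** The cells are open intervals with rational end points. On irrational
    numbers they are described by their branch, since membership in the cell
    amounts to [m < t < m + 1], with [1/2 < t] if [m = 0], for
    [t = (theta^-1 - 2 N)^-1]. *)
Lemma cell_branch_of (A : set (measurableTypeR R)) : cf_partition A ->
  exists b, forall theta, irr01 theta -> A theta <-> branch_of theta = b.
Proof.
move=> pA.
suff [b bP] : exists b, forall theta, irr01 theta ->
    A theta <-> admissible b (forward b theta).
  exists b => theta it; rewrite bP//; split; first exact: admissible_branch_of.
  by move=> <-; have [-> ] := branch_of_spec it.
case: pA => [[->|[k [k0 ->]]]|[n [m [n0 m0 ->]]]].
- by exists None => theta it; rewrite /admissible /= in_itv/=; split; lra.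
- exists (Some (0, k.-1)%N) => theta it; rewrite /= in_itv/=.
  have [/andP[t0 t1] irr] := it.
  have K1 : 1 <= k%:R :> R by rewrite ler1n.
  rewrite [(_ + 2)%:R]natrD [(_ + 1)%:R]natrD natrM.
  split=> [/andP[h1 h2]|a].
    have v1 : theta^-1 < 2 * k%:R + 2.
      by rewrite -[ltRHS]invrK ltf_pV2 ?posrE// invr_gt0; lra.
    have v2 : 2 * k%:R + 1 < theta^-1.
      by rewrite -[ltLHS]invrK ltf_pV2 ?posrE// invr_gt0; lra.
    rewrite /admissible /forward prednK//.
    have u0 : 1 < theta^-1 - 2 * k%:R by lra.
    rewrite subr0 invr_gt0 invf_lt1 ?(lt_trans ltr01)// u0/=.
    by rewrite lef_pV2 ?posrE//; lra.
  have := branch_forward a; set y := forward _ _ => tE.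
  have /andP[/andP[y0 y1] yh] : admissible (Some (0, k.-1)%N) y := a.
  have yn : 2^-1 < y.
    rewrite lt_neqAle yh andbT; apply/eqP => yE; apply: irr.
    exists (2 * k + 2)%:R^-1 => //; rewrite fmorphV/= rmorph_nat -tE -yE /= prednK//.
    by rewrite natrD natrM add0r; field; lra.
  have D : 0 < 2 * k%:R * y + 1 by nra.
  rewrite -tE /= prednK// add0r; apply/andP; split.
    by rewrite ltr_pdivlMr// mulrC ltr_pdivrMr; nra.
  by rewrite ltr_pdivrMr// mulrC ltr_pdivlMr; nra.
- exists (Some (m, n.-1)%N) => theta it; rewrite /= in_itv/=.
  have [/andP[t0 t1] irr] := it.
  have N1 : 1 <= n%:R :> R by rewrite ler1n.
  have M1 : 1 <= m%:R :> R by rewrite ler1n.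
  have nm : 0 <= n%:R * m%:R :> R by rewrite mulr_ge0.
  rewrite [(_ * m + 1)%:R]natrD [(_ * m.+1 + 1)%:R]natrD !natrM -[m.+1%:R]natr1.
  split=> [/andP[h1 h2]|a].
    rewrite /admissible /forward prednK//.
    have D : 0 < 2 * n%:R * m%:R + 1 :> R by lra.
    have D' : 0 < 2 * n%:R * (m%:R + 1) + 1 :> R by lra.
    rewrite ltr_pdivrMr// in h1; rewrite ltr_pdivlMr// in h2.
    have u0 : 0 < 1 - 2 * n%:R * theta by nra.
    have uE : theta^-1 - 2 * n%:R = (1 - 2 * n%:R * theta) / theta.
      by field; rewrite gt_eqF.
    rewrite uE invf_div.
    have h3 : m%:R < theta / (1 - 2 * n%:R * theta) by rewrite ltr_pdivlMr//; lra.
    have h4 : theta / (1 - 2 * n%:R * theta) < m%:R + 1 by rewrite ltr_pdivrMr//; lra.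
    by case: m m0 {nm M1 h1 h2 D D'} h3 h4 => // m _ h3 h4; rewrite andbT; lra.
  have := branch_forward a; set y := forward _ _ => tE.
  have /andP[/andP[y0 y1] _] : admissible (Some (m, n.-1)%N) y := a.
  have D : 0 < 2 * n%:R * m%:R + 1 :> R by lra.
  have D' : 0 < 2 * n%:R * (m%:R + 1) + 1 :> R by lra.
  have ny : 0 <= n%:R * y by rewrite mulr_ge0// ltW.
  have D2 : 0 < 2 * n%:R * (m%:R + y) + 1 by lra.
  rewrite -tE /= prednK//; apply/andP; split.
    by rewrite ltr_pdivrMr// mulrAC ltr_pdivlMr//; nra.
  by rewrite ltr_pdivrMr// mulrAC ltr_pdivlMr//; nra.
Qed.

End Cylinders.

(** * Exponential mixing of cylinders *)

Section CylinderMixing.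
Context {R : realType}.
Notation leb := (@lebesgue_measure R).
Implicit Types (x y M : R) (V U : set (measurableTypeR R)) (f : R -> R).

Lemma measurable_cf_sigma_algebra s U : cf_sigma_algebra s U -> measurable U.
Proof.
suff [sC GC] : sigma_algebra (@circle R) (@measurable _ (measurableTypeR R)) /\
    [set U | exists i A, [/\ (i < s)%N, cf_partition A & U = iter i (@g_preimage R) A]]
      `<=` (@measurable _ (measurableTypeR R)).
  by move=> sU; exact: (sU _ (conj sC GC)).
split; [split|].
- exact: measurable0.
- by move=> A mA; apply: measurableD => //; exact: measurable_circle.
- by move=> A mA; exact: bigcup_measurable.
move=> _ [i [A [_ pA ->]]]; apply: measurable_iter_g_preimage.
by case: pA => [[->|[k [_ ->]]]|[n [m [_ _ ->]]]]; exact: measurable_itv.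
Qed.

(** The sets that are unions of cylinders up to rational numbers form a
    sigma-algebra on the circle which contains the generators. *)
Lemma cf_sigma_algebra_itinerary s U : cf_sigma_algebra s U ->
  exists S, @irr01 R `&` U = itinerary_set s S.
Proof.
pose C U := exists S, @irr01 R `&` U = itinerary_set s S.
suff [sC GC] : sigma_algebra (@circle R) C /\
    [set U | exists i A, [/\ (i < s)%N, cf_partition A & U = iter i (@g_preimage R) A]] `<=` C.
  by move=> sU; exact: (sU C).
split; [split|].
- by exists set0; rewrite setI0; apply/seteqP; split=> // x [].
- move=> A [S SP]; exists (~` S); apply/seteqP; split=> x.
    move=> [ix [_ nA]]; split => // Sx; apply: nA.
    by have : itinerary_set s S x := conj ix Sx; rewrite -SP => -[].
  move=> [ix nS]; split => //; split.
    by have [/andP[x0 x1] _] := ix; rewrite /circle /= in_itv/= x1 ltW.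
  move=> Ax; have : (@irr01 R `&` A) x := conj ix Ax.
  by rewrite SP => -[].
- move=> A /choice[S SP]; exists (\bigcup_k S k).
  rewrite setI_bigcupr; apply/seteqP; split=> x.
    by move=> [k _]; rewrite SP => -[ix Sx]; split => //; exists k.
  by move=> [ix [k _ Sx]]; exists k => //; rewrite SP.
move=> _ [i [A [si pA ->]]].
have [b bP] := cell_branch_of pA; exists [set w | nth None w i = b].
apply/seteqP; split=> x.
  move=> [ix]; rewrite iter_g_preimageP// => /bP; move=> /(_ (iter_irr01 i ix)) h.
  by split => //=; rewrite nth_mkseq.
move=> [ix /=]; rewrite nth_mkseq// => h; split => //.
by rewrite iter_g_preimageP//; apply/bP => //; exact: iter_irr01.
Qed.

Lemma rho_Rint_irr01 M f V : measurable V -> bounded_mfun M f ->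
  rho_Rint f (@irr01 R `&` V) = rho_Rint f V.
Proof.
move=> mV [mf f0]; rewrite /rho_Rint rho_int_irr01// => x.
by have /andP[] := f0 x.
Qed.

Lemma bounded_mfun1 : bounded_mfun 1 (cst 1 : R -> R).
Proof. by apply: bounded_mfun_cst; rewrite ler01 lexx. Qed.

Lemma rho_Rint_subset M f V V' : bounded_mfun M f -> measurable V -> measurable V' ->
  V `<=` V' -> rho_Rint f V <= rho_Rint f V'.
Proof.
move=> tf mV mV' VV'; rewrite -lee_fin !(rho_RintE tf)//.
apply: ge0_subset_integral => //.
  by apply: measurable_funTS; apply: measurable_mulr_rho; exact: tf.1.
by move=> x _; rewrite lee_fin mulr_ge0 ?rho_ge0//; have /andP[] := tf.2 x.
Qed.

Lemma rho_Rint1_itv (p q : R) : 0 <= p -> p <= q -> q <= 1 ->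
  q - p <= rho_Rint (cst 1) `]p, q[%classic.
Proof.
move=> p0 pq q1; rewrite -lee_fin (rho_RintE bounded_mfun1); last exact: measurable_itv.
have <- : leb `]p, q[%classic = (q - p)%:E.
  apply: lebesgue_measure_between => //.
  exact: subset_itv_oo_cc.
rewrite -[leLHS]mul1e -integral_cst//.
apply: ge0_le_integral => //.
  by apply: measurable_funTS; exact: measurable_mulr_rho.
move=> x; rewrite /= in_itv/= => xpq; rewrite lee_fin mul1r.
by have /andP[] // : 1 <= rho x <= 8 / 3 by apply: rho_itv; lra.
Qed.

(** By bounded distortion [f] varies by a factor at most [1 + 16/2 = 9] on each
    half. A half has [rho]-mass at least [1/2], so [f] is at most [2 * 9 = 18]
    times its integral [u]. The Lipschitz constants of [f] are then at most
    [16 * 18 u <= 10 * 36 u] and [10 * 18 u = 5 * 36 u]. *)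
Lemma distorted_regular f : bounded_mfun 1 f -> distorted f ->
  regular (36 * rho_Rint f setT) f.
Proof.
move=> tf [dl du]; set u := rho_Rint f setT.
have f0 x : 0 <= f x by have /andP[] := tf.2 x.
have u0 : 0 <= u by exact: rho_Rint_ge0.
have tc (c : R) : 0 <= c -> bounded_mfun c (cst c).
  by move=> c0; apply: bounded_mfun_cst; rewrite c0 lexx.
have mean y p q : 0 <= p -> p + 2^-1 <= q -> q <= 1 ->
    (forall z, p < z < q -> f y <= 9 * f z) -> f y <= 18 * u.
  move=> p0 pq q1 h.
  have mI : measurable (`]p, q[%classic : set (measurableTypeR R)) by exact: measurable_itv.
  have t9 : bounded_mfun (9 * 1) (fun x => 9 * f x).
    split; first by apply: measurable_funM => //; exact: tf.1.
    by move=> x; have /andP[? ?] := tf.2 x; rewrite mulr_ge0//= ler_wpM2l.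
  have h1 : f y * rho_Rint (cst 1) `]p, q[%classic <= 9 * u.
    rewrite -(rho_Rint_cst (f0 y))//.
    apply: (@le_trans _ _ (rho_Rint (fun x => 9 * f x) `]p, q[%classic)).
      apply: (rho_Rint_le (tc _ (f0 y)) t9) => // z _ zI; apply: h.
      by move: zI; rewrite /= in_itv.
    rewrite (rho_Rint_scale tf)// ler_wpM2l//; exact: (rho_Rint_subset tf).
  have h2 : q - p <= rho_Rint (cst 1) `]p, q[%classic by apply: rho_Rint1_itv => //; lra.
  have := f0 y; nra.
have ub y : 0 < y < 1 -> f y <= 18 * u.
  move=> y01; have [yh|yh] := ltP y 2^-1.
    apply: (mean _ 0 2^-1) => //; try lra.
    move=> z zh; apply: le_trans (dl y z _ _) _; try lra.
    rewrite ler_wpM2r// ; have : `|y - z| <= 2^-1 by rewrite ler_norml; lra.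
    by lra.
  apply: (mean _ 2^-1 1) => //; try lra.
  move=> z zh; apply: le_trans (du y z _ _) _; try lra.
  rewrite ler_wpM2r// ; have : `|y - z| <= 2^-1 by rewrite ler_norml; lra.
  by lra.
split=> y z y0 z0.
- by have := ub _ y0; have := f0 z; lra.
- apply: le_trans (dl _ _ y0 z0) _; have : f z <= 18 * u by apply: ub; lra.
  by have := normr_ge0 (y - z); have := f0 z; nra.
- apply: le_trans (du _ _ y0 z0) _; have : f z <= 18 * u by apply: ub; lra.
  by have := normr_ge0 (y - z); have := f0 z; nra.
Qed.

Lemma cylinder_mixing s j S V : measurable V ->
  `|rho_Rint (cst 1) (itinerary_set s S `&` iter (s + j) (@g_preimage R) V) * total_mass
    - rho_Rint (cst 1) (itinerary_set s S) * rho_Rint (cst 1) V| <=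
  (71 / 72) ^+ j * (36 * rho_Rint (cst 1) (itinerary_set s S)) * total_mass * rho_Rint (cst 1) V.
Proof.
move=> mV; have [mU [f [tf df fE]]] := @cylinder_density R s S.
have uE : rho_Rint (cst 1) (itinerary_set s S) = rho_Rint f setT.
  rewrite /rho_Rint -fE//; congr (fine (rho_int _ _)); apply/seteqP; split=> x; last by case.
  by move=> [ix Sx]; split => //; rewrite iter_g_preimageP.
have -> : rho_Rint (cst 1) (itinerary_set s S `&` iter (s + j) (@g_preimage R) V) =
    rho_Rint f (iter j (@g_preimage R) V).
  by have mW := measurable_iter_g_preimage j mV; rewrite /rho_Rint iterD fE.
rewrite uE; apply: (mixing_bound _ _ tf) => //.
  by rewrite mulr_ge0// rho_Rint_ge0// => x; have /andP[] := tf.2 x.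
exact: distorted_regular.
Qed.

End CylinderMixing.

(** * The invariant probability *)

Section InvariantProbability.
Context {R : realType}.
Notation leb := (@lebesgue_measure R).
Implicit Types (V U : set (measurableTypeR R)).

Let Z0 : 0 < @total_mass R.
Proof. by have /andP[h _] := @total_mass_bounds R; lra. Qed.

Definition invariant_density (x : measurableTypeR R) : R := rho x / total_mass.

Lemma measurable_invariant_density : measurable_fun setT invariant_density.
Proof. by apply: measurable_funM => //; exact: measurable_rho. Qed.

Lemma invariant_density_ge0 x : 0 <= invariant_density x.
Proof. by rewrite divr_ge0 ?rho_ge0// ltW. Qed.

Lemma integral_invariant_density V : measurable V ->
  (\int[leb]_(x in V) (invariant_density x)%:E = (rho_Rint (cst 1) V / total_mass)%:E)%E.
Proof.
move=> mV; rewrite mulrC EFinM (rho_RintE bounded_mfun1)// /rho_int -ge0_integralZl//.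
- by apply: eq_integral => x _; rewrite -EFinM mul1r mulrC.
- by apply: measurable_funTS; exact: measurable_mulr_rho.
- by move=> x _; rewrite lee_fin mul1r rho_ge0.
- by rewrite lee_fin invr_ge0 ltW.
Qed.

Lemma invariant_density_lty : (\int[leb]_x (invariant_density x)%:E < +oo)%E.
Proof. by rewrite integral_invariant_density ?ltry//; exact: measurableT. Qed.

Definition g_prob : set (measurableTypeR R) -> \bar R :=
  density_measure measurable_invariant_density invariant_density_ge0 invariant_density_lty.

HB.instance Definition _ := Measure.on g_prob.

Lemma g_probE V : measurable V -> g_prob V = (rho_Rint (cst 1) V / total_mass)%:E.
Proof. exact: integral_invariant_density. Qed.

Let g_prob_setT : g_prob setT = 1%E.
Proof.
rewrite g_probE; last exact: measurableT.
by rewrite divff// gt_eqF.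
Qed.

HB.instance Definition _ := Measure_isProbability.Build _ _ _ g_prob g_prob_setT.

(** The normalised density is at least [3/8], since [rho >= 1] and
    [total_mass <= 8/3]. *)
Lemma dx_le_g_prob V : measurable V -> (dx V <= (8 / 3)%:E * g_prob V)%E.
Proof.
move=> mV; rewrite g_probE//.
have -> : dx V = leb (V `&` @circle R) by [].
have m01 : measurable (V `&` `]0, 1[ : set (measurableTypeR R)).
  by apply: measurableI => //; exact: measurable_itv.
have mVc : measurable (V `&` @circle R) by apply: measurableI => //; exact: measurable_circle.
apply: (@le_trans _ _ (leb (V `&` `]0, 1[))).
  rewrite -[leRHS]adde0 -(lebesgue_measure_set1 0).
  apply: le_trans (measureU2 _ _ _) => //.
  apply: le_measure; rewrite ?inE//; first exact: measurableU.
  move=> x [Vx]; rewrite /circle /= in_itv/= => /andP[]; rewrite le_eqVlt => /predU1P[<- _|x0 x1].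
    by right.
  by left; split => //; rewrite /= in_itv/= x0.
apply: (@le_trans _ _ (rho_Rint (cst 1) V)%:E); last first.
  rewrite -EFinM lee_fin mulrCA ler_peMr ?rho_Rint_ge0//.
  by rewrite ler_pdivlMr// mul1r; have /andP[] := @total_mass_bounds R.
rewrite (rho_RintE bounded_mfun1)// -[leLHS]mul1e -integral_cst//.
rewrite integral_mkcondr /rho_int; apply: ge0_le_integral => //.
- by move=> x _; rewrite patchE; case: ifP.
- apply: measurable_funTS; apply/(measurable_restrictT _ _).1 => //.
- by apply: measurable_funTS; exact: measurable_mulr_rho.
move=> x _; rewrite patchE mul1r; case: ifPn => [|_]; last by rewrite lee_fin rho_ge0.
by rewrite inE /= in_itv/= => /rho_itv/andP[r1 _]; rewrite lee_fin.
Qed.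

(** The normalised density is at most [8/3], since [rho <= 8/3] and
    [total_mass >= 1]. *)
Lemma g_prob_le_dx V : measurable V -> (g_prob V <= (8 / 3)%:E * dx V)%E.
Proof.
move=> mV; rewrite g_probE//.
have -> : dx V = leb (V `&` @circle R) by [].
have mVc : measurable (V `&` @circle R) by apply: measurableI => //; exact: measurable_circle.
apply: (@le_trans _ _ (rho_Rint (cst 1) V)%:E).
  rewrite lee_fin ler_pdivrMr// ler_peMr ?rho_Rint_ge0//.
  by have /andP[] := @total_mass_bounds R.
rewrite (rho_RintE bounded_mfun1)// -integral_cst// /rho_int [leRHS]integral_mkcondr.
apply: ge0_le_integral => //.
- by move=> x _; rewrite lee_fin mulr_ge0 ?rho_ge0.
- by apply: measurable_funTS; exact: measurable_mulr_rho.
- apply: measurable_funTS; apply/(measurable_restrictT _ _).1 => //; exact: measurable_circle.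
move=> x _; rewrite patchE mul1r; case: ifPn => [_|].
  have [x01|x01] := boolP (0 < x < 1); last by rewrite /rho (negbTE x01) lee_fin divr_ge0.
  by rewrite lee_fin; have /andP[] := rho_itv x01.
rewrite notin_setE /circle /= in_itv/= => /negP x01.
rewrite /rho; case: ifP => // /andP[x0 x1]; exfalso; move: x01; rewrite x1 andbT.
by rewrite (ltW x0).
Qed.

Lemma g_prob_equivalent : equivalent_to_dx g_prob.
Proof.
have dx0 V : (0 <= dx V)%E by exact: measure_ge0.
have mu0 V : (0 <= g_prob V)%E by exact: measure_ge0.
split; apply/null_content_dominatesP => A mA A0; apply/eqP; rewrite eq_le.
  by rewrite mu0 andbT; apply: le_trans (g_prob_le_dx mA) _; rewrite A0 mule0.
by rewrite dx0 andbT; apply: le_trans (dx_le_g_prob mA) _; rewrite A0 mule0.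
Qed.

Lemma g_prob_preserved : preserved_by_g g_prob.
Proof.
move=> V mV _; have mgV := measurable_g_preimage mV.
rewrite [LHS]g_probE// [RHS]g_probE//.
by rewrite /rho_Rint rho_int_invariant.
Qed.

(** Relative to the product of the masses, the bound of [cylinder_mixing] is
    [36 * total_mass <= 36 * 8/3 = 96 <= 100 * 71/72] times a power of [71/72],
    whose exponent is the gap [r - 1]. *)
Lemma psi_le r : (1 <= r)%N -> (psi g_prob r <= (100 * (71 / 72) ^+ r)%:E)%E.
Proof.
move=> r1; apply: ge_ereal_sup => _ [s [U [V [s0 [sU U0] [mV _ V0] ->]]]].
have [S SP] := cf_sigma_algebra_itinerary sU.
have mS : measurable (itinerary_set s S : set (measurableTypeR R)) := (@cylinder_density R s S).1.
have sj : (s + r - 1 = s + r.-1)%N by rewrite -[in LHS](prednK r1) addnS subn1.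
have irrE (A : set (measurableTypeR R)) : measurable A ->
    (g_prob : probability (measurableTypeR R) R) A =
    (rho_Rint (cst 1) (@irr01 R `&` A) / total_mass)%:E.
  by move=> mA; rewrite (rho_Rint_irr01 _ bounded_mfun1)//; exact: g_probE.
have mU := measurable_cf_sigma_algebra sU.
have mW := measurable_iter_g_preimage (s + r.-1) mV.
rewrite sj (irrE (U `&` _)); last exact: measurableI.
move: U0 V0; rewrite (irrE U)// (irrE V)// setIA SP
  (rho_Rint_irr01 mV bounded_mfun1) !lte_fin lee_fin => U0 V0.
set u := rho_Rint _ (itinerary_set s S) in U0 *; set v := rho_Rint _ V in V0 *.
have Zb := @total_mass_bounds R; have Zn : @total_mass R != 0 by rewrite gt_eqF.
have u0 : 0 < u by move: U0; rewrite pmulr_lgt0// invr_gt0.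
have v0 : 0 < v by move: V0; rewrite pmulr_lgt0// invr_gt0.
have := @cylinder_mixing R s r.-1 S V mV; rewrite -/u -/v.
set w := rho_Rint _ _ => h.
rewrite /=  (_ : _ - 1 = (w * total_mass - u * v) / (u * v)); last first.
  by field; rewrite Zn !gt_eqF.
rewrite normrM normfV (gtr0_norm (mulr_gt0 u0 v0)) ler_pdivrMr ?mulr_gt0//.
apply: (le_trans h); rewrite -[r in leRHS]prednK// exprS.
set k := _ ^+ _; have k0 : 0 <= k by rewrite exprn_ge0// divr_ge0.
have kuv : 0 <= k * (u * v) by rewrite !mulr_ge0// ltW.
case/andP: Zb => _ Zb.
by nra.
Qed.

End InvariantProbability.

(** * Ergodicity *)

Section Ergodicity.
Context {R : realType}.
Notation leb := (@lebesgue_measure R).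
Implicit Types (x y M : R) (V P : set (measurableTypeR R)) (f : R -> R).
Notation q := (rho_Rint (cst (1 : R))).

Let Z0 : 0 < @total_mass R.
Proof. by have /andP[h _] := @total_mass_bounds R; lra. Qed.

Lemma rho_Rint1_g_prob V : measurable V -> q V = total_mass * fine (g_prob V).
Proof. by move=> mV; rewrite g_probE//= mulrC divfK// gt_eqF. Qed.

Lemma rho_Rint1_ge0 V : 0 <= q V.
Proof. exact: rho_Rint_ge0. Qed.

Lemma rho_Rint1_setU V V' : measurable V -> measurable V' -> V `&` V' = set0 ->
  q (V `|` V') = q V + q V'.
Proof.
move=> mV mV' VV'; have mU : measurable (V `|` V') by exact: measurableU.
rewrite !rho_Rint1_g_prob// -mulrDr; congr (_ * _).
rewrite measureU// fineD//; exact: fin_num_measure.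
Qed.

(** [64/9] is the square of [8/3]: one factor bounds the normalised density,
    the other one [total_mass]. *)
Lemma rho_Rint1_itv_le (b c : R) : b <= c -> q `]b, c]%classic <= 64 / 9 * (c - b).
Proof.
move=> bc.
have mI : measurable (`]b, c]%classic : set (measurableTypeR R)) by exact: measurable_itv.
have h : (g_prob `]b, c]%classic <= (8 / 3)%:E * (c - b)%:E)%E.
  apply: le_trans (g_prob_le_dx mI) _; rewrite lee_wpmul2l ?lee_fin ?divr_ge0//.
  rewrite -(@lebesgue_measure_between _ b c `]b, c]%classic)//.
  - by apply: le_measure; rewrite ?inE//; apply: measurableI => //; exact: measurable_circle.
  - exact: subset_itv_oo_oc.
  - exact: subset_itv_oc_cc.
rewrite g_probE// -EFinM lee_fin ler_pdivrMr// in h.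
have /andP[_ Zb] := @total_mass_bounds R.
have d0 : 0 <= c - b by rewrite subr_ge0.
by apply: le_trans h _; nra.
Qed.

Lemma geometric_bound_eq0 (c X : R) : (forall j, `|X| <= (71 / 72) ^+ j * c) -> X = 0.
Proof.
move=> h; apply/eqP; rewrite -normr_le0.
have cv : (71 / 72 : R) ^+ j * c @[j --> \oo] --> 0 * c.
  apply: cvgM; last exact: cvg_cst.
  by apply: cvg_expr; rewrite ger0_norm ?divr_ge0// ltr_pdivrMr//; lra.
rewrite -[leRHS](mul0r c) -(cvg_lim _ cv)//.
apply: limr_ge; first by apply/cvg_ex; exists (0 * c).
by near=> j; exact: h.
Unshelve. all: by end_near. Qed.

(** Invariance is only required up to a null set, which is what equality of
    the integrals of all bounded densities expresses. *)
Section InvariantSet.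
Context P (mP : measurable P)
  (invP : forall M f, bounded_mfun M f -> rho_Rint f (g_preimage P) = rho_Rint f P).

Lemma rho_Rint_iter_invariant M j f : bounded_mfun M f ->
  rho_Rint f (iter j (@g_preimage R) P) = rho_Rint f P.
Proof.
elim: j f => // j ih f tf; have mW := measurable_iter_g_preimage j mP.
rewrite iterS -[RHS](invP tf) /rho_Rint !(@rho_int_g_preimage _ _ M);
  try exact: tf.1; try exact: tf.2; last by [].
- exact: (ih _ (bounded_mfun_transfer tf)).
- by [].
Qed.

Lemma rho_Rint_invariant_set M A f : 0 <= A -> bounded_mfun M f -> regular A f ->
  rho_Rint f P * total_mass = rho_Rint f setT * q P.
Proof.
move=> A0 tf rf; apply/eqP; rewrite -subr_eq0; apply/eqP.
apply: (@geometric_bound_eq0 (A * total_mass * q P)) => j.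
have := mixing_bound j A0 tf rf mP; rewrite (rho_Rint_iter_invariant j tf).
by rewrite !mulrA.
Qed.

(** A Lipschitz approximation, from above, of the indicator of the ray of
    points at most [b]. Indicators of intervals are not [regular], but their
    approximations are, and they suffice to determine a measure. *)
Definition ramp (k b y : R) : R := Num.max 0 (Num.min 1 (1 + k * (b - y))).

Lemma bounded_mfun_ramp k b : bounded_mfun 1 (ramp k b).
Proof.
split; last first.
  by move=> x; rewrite /ramp le_max lexx/= ge_max ler01 ge_min lexx.
apply: measurable_maxr => //; apply: measurable_minr => //.
by apply: measurable_funD => //; apply: measurable_funM => //; exact: measurable_funB.
Qed.

Lemma ramp_lipschitz k b y z : 0 <= k -> ramp k b y <= ramp k b z + k * `|y - z|.
Proof.
move=> k0; have : k * (z - y) <= k * `|y - z| by rewrite ler_wpM2l// distrC ler_norm.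
have : 0 <= k * `|y - z| by rewrite mulr_ge0.
rewrite /ramp; move: (k * `|y - z|) => d d0 dk.
rewrite ge_max addr_ge0 ?le_max ?lexx//=.
have [v1|v1] := leP 1 (1 + k * (b - z)).
  by rewrite (max_idPr ler01) ge_min lerDl d0.
rewrite ge_min; apply/orP; right; rewrite -lerBlDr le_max; apply/orP; right; lra.
Qed.

Lemma ramp_eq1 k b y : 0 <= k -> y <= b -> ramp k b y = 1.
Proof.
move=> k0 yb; rewrite /ramp (min_idPl _) ?(max_idPr ler01)//.
by rewrite lerDl mulr_ge0// subr_ge0.
Qed.

Lemma ramp_eq0 k b y : 0 < k -> b + k^-1 <= y -> ramp k b y = 0.
Proof.
move=> k0 yb; rewrite /ramp; apply/max_idPl; rewrite ge_min; apply/orP; right.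
have : k * (y - b) >= 1 by rewrite -ler_pdivrMl// mulr1 lerBrDl.
lra.
Qed.

Lemma regular_ramp k b : 1 <= k -> regular k (ramp k b).
Proof.
move=> k1; have [_ c01] := bounded_mfun_ramp k b; have k0 : 0 <= k by lra.
split=> y z _ _.
- by have /andP[_ h] := c01 y; have /andP[h' _] := c01 z; lra.
- by have := ramp_lipschitz b y z k0; have := normr_ge0 (y - z); nra.
- by have := ramp_lipschitz b y z k0; have := normr_ge0 (y - z); nra.
Qed.

Lemma rho_Rint_mkcond M f V V' : bounded_mfun M f -> measurable V -> measurable V' ->
  (forall x, ~ V x -> f x = 0) -> rho_Rint f V' = rho_Rint f (V' `&` V).
Proof.
move=> tf mV mV' fV; rewrite /rho_Rint /rho_int [in RHS]integral_mkcondr.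
congr fine; apply: eq_integral => x _; rewrite patchE.
by case: ifPn => //; rewrite notin_setE => /fV ->; rewrite mul0r.
Qed.

Lemma ramp_between k b V : 1 <= k -> measurable V ->
  q (`]-oo, b] `&` V) <= rho_Rint (ramp k b) V <= q (`]-oo, b] `&` V) + 8 * k^-1.
Proof.
move=> k1 mV; have k0 : 0 < k by lra.
have tk := bounded_mfun_ramp k b; have t1 := @bounded_mfun1 R.
have mbV : measurable (`]-oo, b] `&` V : set (measurableTypeR R)) by exact: measurableI.
have bc : b <= b + k^-1 by rewrite lerDl invr_ge0 ltW.
have mcV : measurable (`]-oo, b + k^-1] `&` V : set (measurableTypeR R)) by exact: measurableI.
apply/andP; split.
  apply: (@le_trans _ _ (rho_Rint (ramp k b) (`]-oo, b] `&` V))).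
    apply: (rho_Rint_le t1 tk) => // x _ [xb _] /=.
    by rewrite ramp_eq1// ?ltW//; move: xb; rewrite /= in_itv.
  by apply: (rho_Rint_subset tk).
rewrite (@rho_Rint_mkcond _ _ `]-oo, b + k^-1] _ tk)//; last first.
  move=> x /=; rewrite in_itv/= => /negP; rewrite -ltNge => h.
  by rewrite ramp_eq0// ltW.
rewrite setIC; apply: (@le_trans _ _ (q (`]-oo, b + k^-1] `&` V))).
  apply: (rho_Rint_le tk t1) => // x _ _ /=; by have /andP[] := tk.2 x.
have mI : measurable (`]b, b + k^-1]%classic : set (measurableTypeR R)) by exact: measurable_itv.
have mIV : measurable (`]b, b + k^-1] `&` V : set (measurableTypeR R)) by exact: measurableI.
have -> : `]-oo, b + k^-1] `&` V = (`]-oo, b] `&` V) `|` (`]b, b + k^-1] `&` V).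
  rewrite -setIUl; congr (_ `&` V); apply/seteqP; split=> x /=; rewrite !in_itv/=.
    by move=> xc; have [xb|xb] := leP x b; [left|right; rewrite xc].
  by move=> [xb|/andP[_]//]; exact: le_trans bc.
rewrite rho_Rint1_setU//; last first.
  apply/seteqP; split=> // x [[xb _] [xc _]]; move: xb xc; rewrite /= !in_itv/=.
  by move=> h /andP[]; rewrite ltNge h.
rewrite lerD2l; apply: (@le_trans _ _ (q `]b, b + k^-1]%classic)).
  by apply: (rho_Rint_subset t1) => //; exact: subIsetl.
apply: le_trans (rho_Rint1_itv_le bc) _; rewrite addrAC subrr add0r.
by rewrite ler_wpM2r ?invr_ge0 ?ltW//; lra.
Qed.

(** Let [k] tend to infinity in [ramp_between]. *)
Lemma rho_Rint1_ray_invariant b :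
  q (`]-oo, b] `&` P) * total_mass = q `]-oo, b]%classic * q P.
Proof.
have E k : 1 <= k -> rho_Rint (ramp k b) P * total_mass = rho_Rint (ramp k b) setT * q P.
  move=> k1; apply: (rho_Rint_invariant_set _ (bounded_mfun_ramp k b) (regular_ramp b k1)); lra.
have lim0 (X c : R) : 0 <= c -> (forall k : R, 1 <= k -> X <= c * k^-1) -> X <= 0.
  move=> c0 h; rewrite leNgt; apply/negP => X0.
  have D1 : 1 <= 2 * c / X + 1.
    by rewrite lerDr; apply: divr_ge0; [rewrite mulr_ge0|exact: ltW].
  have D : 0 < 2 * c / X + 1 by exact: lt_le_trans D1.
  have := h _ D1; rewrite ler_pdivlMr// mulrDr mulr1 mulrCA divff ?gt_eqF//; lra.
have p0 := rho_Rint1_ge0 P.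
apply/eqP; rewrite eq_le; apply/andP; split; rewrite -subr_le0.
  apply: (lim0 _ (8 * q P)); first by rewrite mulr_ge0.
  move=> k k1; have := E _ k1; have /andP[h1 _] := ramp_between b k1 mP.
  have /andP[_ h2] := ramp_between b k1 (@measurableT _ (measurableTypeR R)).
  rewrite setIT in h2 => e; have := ler_wpM2r (ltW Z0) h1; have := ler_wpM2r p0 h2.
  by rewrite e; lra.
apply: (lim0 _ (8 * total_mass)); first by rewrite mulr_ge0// ltW.
move=> k k1; have := E _ k1; have /andP[_ h1] := ramp_between b k1 mP.
have /andP[h2 _] := ramp_between b k1 (@measurableT _ (measurableTypeR R)).
rewrite setIT in h2 => e; have := ler_wpM2r (ltW Z0) h1; have := ler_wpM2r p0 h2.
by rewrite e; lra.
Qed.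

(** An invariant set is independent of every ray, hence of every Borel set by
    uniqueness of measures, hence of itself. *)
Lemma invariant_set_trivial : q P = 0 \/ q P = total_mass.
Proof.
have c0 : 0 <= q P / total_mass by rewrite divr_ge0 ?rho_Rint1_ge0// ltW.
pose m1 : {measure set (measurableTypeR R) -> \bar R} := mrestr (@g_prob R) mP.
pose m2 : {measure set (measurableTypeR R) -> \bar R} := mscale (NngNum c0) (@g_prob R).
have m12 A : measurable A -> m1 A = m2 A.
  apply: finite_measure_unique.
    rewrite /m1 /= /mrestr; apply: le_lt_trans (probability_le1 _ _) (ltry 1).
    by apply: measurableI.
  move=> a b ab; rewrite /m1 /m2 /= /mrestr /mscale /=.
  have mI : measurable (`]a, b]%classic : set (measurableTypeR R)) by exact: measurable_itv.
  have mIP : measurable (`]a, b] `&` P : set (measurableTypeR R)) by exact: measurableI.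
  rewrite !g_probE// -EFinM; congr EFin.
  have U : (`]-oo, b]%classic : set (measurableTypeR R)) = `]-oo, a]%classic `|` `]a, b]%classic.
    apply/seteqP; split=> x /=; rewrite !in_itv/=.
      by move=> xb; have [xa|xa] := leP x a; [left|right; rewrite xb].
    by move=> [xa|/andP[_]//]; apply: le_trans xa _; exact: ltW.
  have D : (`]-oo, a]%classic : set (measurableTypeR R)) `&` `]a, b]%classic = set0.
    apply/seteqP; split=> // x [] /=; rewrite !in_itv/=.
    by move=> h /andP[]; rewrite ltNge h.
  have e1 : q `]-oo, b]%classic = q `]-oo, a]%classic + q `]a, b]%classic.
    by rewrite U rho_Rint1_setU.
  have e2 : q (`]-oo, b] `&` P) = q (`]-oo, a] `&` P) + q (`]a, b] `&` P).
    rewrite U setIUl rho_Rint1_setU//; first exact: measurableI.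
    by rewrite setIACA D set0I.
  have := rho_Rint1_ray_invariant b; have := rho_Rint1_ray_invariant a.
  rewrite e1 e2 => h1 h2.
  have h : q (`]a, b] `&` P) * total_mass = q `]a, b]%classic * q P by lra.
  have Zn : @total_mass R != 0 by rewrite gt_eqF.
  rewrite -[X in X / _ = _](mulfK Zn) h.
  by field.
have := m12 _ mP; rewrite /m1 /m2 /= /mrestr /mscale /= setIid !g_probE// -EFinM => -[].
have Zn : @total_mass R != 0 by rewrite gt_eqF.
move=> h; have : q P * (total_mass - q P) = 0.
  have := congr1 (fun x => x * total_mass ^+ 2) h.
  rewrite expr2 !mulrA divfK// [X in _ = X -> _](_ : _ = q P * q P); last by field.
  by move=> ?; lra.
by move/eqP; rewrite mulf_eq0 subr_eq0 => /orP[/eqP->|/eqP->]; [left|right].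
Qed.

End InvariantSet.
End Ergodicity.

(** * Radon-Nikodym derivatives *)

Section BoundedDerivative.
Context {d} {T : measurableType d} {R : realType}.
Context (nu mu : {finite_measure set T -> \bar R}).
Local Open Scope ereal_scope.

(** The set where the derivative is at least [C + 1] is null: otherwise its
    [nu]-measure would exceed [C] times its [mu]-measure. *)
Lemma Lnorm_Radon_Nikodym_lty (C : R) : (0 <= C)%R ->
  (forall A, measurable A -> nu A <= C%:E * mu A) ->
  Lnorm mu +oo (Radon_Nikodym (charge_of_finite_measure nu) mu) < +oo.
Proof.
move=> C0 numuC.
have numu : nu `<< mu.
  apply/null_content_dominatesP => A mA A0; apply/eqP; rewrite eq_le measure_ge0 andbT.
  by rewrite (le_trans (numuC _ mA))// A0 mule0.
pose f := Radon_Nikodym_SigmaFinite.f nu mu.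
have f0 x : 0 <= f x by exact: Radon_Nikodym_SigmaFinite.f_ge0.
have mf : measurable_fun setT f.
  exact: measurable_int (Radon_Nikodym_SigmaFinite.f_integrable numu).
pose B := f @^-1` `[(C + 1)%:E, +oo[.
have mB : measurable B.
  by rewrite /B -[X in measurable X]setTI; apply: mf => //; exact: emeasurable_itv.
have B0 : mu B = 0.
  have h : (C + 1)%:E * mu B <= C%:E * mu B.
    apply: le_trans (numuC _ mB).
    rewrite (Radon_Nikodym_SigmaFinite.f_integral numu)// -integral_cst//.
    apply: ge0_le_integral => //.
    - by move=> x _; rewrite lee_fin addr_ge0.
    - exact: measurable_funTS.
    - by move=> x; rewrite /B /= in_itv/= andbT.
  have fB : mu B \is a fin_num by exact: fin_num_measure.
  have mB0 : 0 <= mu B by exact: measure_ge0.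
  move: h; rewrite -(fineK fB) -!EFinM lee_fin mulrDl mul1r gerDl => h.
  by apply/eqP; rewrite eqe eq_le h fine_ge0.
rewrite unlock; case: ifPn => _; last exact: ltry.
apply: (@le_lt_trans _ _ (C + 1)%:E); last exact: ltry.
apply/ess_supP.
have ae1 := ae_eq_Radon_Nikodym_SigmaFinite numu (@measurableT _ T).
have ae2 : {ae mu, forall x, ~ B x}.
  exists B; split => // x /= nB; exact: contrapT.
apply: filterS2 ae1 ae2 => x /= <-// nB.
rewrite gee0_abs// leNgt; apply/negP => fC; apply: nB.
by rewrite /B /= in_itv/= andbT ltW.
Qed.

(** Where the derivative exceeds 1, [nu] exceeds [mu] strictly. *)
Lemma Radon_Nikodym_gt1_null A : nu `<< mu -> measurable A ->
  (forall x, A x -> 1 < Radon_Nikodym_SigmaFinite.f nu mu x) ->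
  nu A <= mu A -> mu A = 0.
Proof.
move=> numu mA A1 numuA; pose f := Radon_Nikodym_SigmaFinite.f nu mu.
have f_fin x : f x \is a fin_num by exact: Radon_Nikodym_SigmaFinite.f_fin_num.
have mf : measurable_fun setT f.
  exact: measurable_int (Radon_Nikodym_SigmaFinite.f_integrable numu).
have mf1 : measurable_fun A (fun x => f x - 1).
  by apply: emeasurable_funB; [exact: measurable_funTS|exact: measurable_cst].
have f1 x : A x -> 0 <= f x - 1 by move=> /A1/ltW h; rewrite sube_ge0.
have nuE : nu A = \int[mu]_(x in A) (f x - 1) + mu A.
  rewrite (Radon_Nikodym_SigmaFinite.f_integral numu)// -[X in _ + X]mul1e.
  rewrite -integral_cst// -ge0_integralD//.
  apply: eq_integral => x _; exact: (esym (@subeK _ (f x) 1 isT)).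
have fA : mu A \is a fin_num by exact: fin_num_measure.
have I0 : \int[mu]_(x in A) (f x - 1) = 0.
  apply/eqP; rewrite eq_le integral_ge0// andbT.
  move: numuA; rewrite nuE -leeBrDr// subee//.
have := (ae_eq_integral_abs mu mA mf1).1.
rewrite (eq_integral (fun x => f x - 1)) => [/(_ I0)|x /[!inE] Ax]; last first.
  by rewrite gee0_abs// f1.
move=> [N [mN N0 AN]]; apply/eqP; rewrite eq_le measure_ge0 andbT -N0.
apply: le_measure; rewrite ?inE// => x Ax; apply: AN => /(_ Ax) fx.
have : 0 < f x - 1 by rewrite sube_gt0; exact: A1.
by rewrite fx ltxx.
Qed.

End BoundedDerivative.

(** * Uniqueness of the invariant probability *)

Section Uniqueness.
Context {R : realType}.
Implicit Types (V A : set (measurableTypeR R)).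

Notation mu := (@g_prob R : probability (measurableTypeR R) R).

Lemma probability_le_eq (nu nu' : probability (measurableTypeR R) R) :
  (forall A, measurable A -> (nu A <= nu' A)%E) ->
  forall A, measurable A -> nu A = nu' A.
Proof.
move=> le A mA; apply/eqP; rewrite eq_le le//=.
have := le _ (measurableC mA); rewrite !probability_setC//.
by rewrite leeD2lE// leeN2.
Qed.

Lemma rho_int_null M f V : bounded_mfun M f -> measurable V -> mu V = 0%E -> rho_int f V = 0%E.
Proof.
move=> tf mV V0; have M0 : 0 <= M by have /andP[/le_trans h /h] := tf.2 0.
have f0 x : 0 <= f x by have /andP[] := tf.2 x.
have tM : bounded_mfun M (cst M : R -> R) by apply: bounded_mfun_cst; rewrite M0 lexx.
rewrite -(rho_RintE tf)//; congr EFin; apply/eqP; rewrite eq_le rho_Rint_ge0// andbT.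
have : rho_Rint f V <= rho_Rint (cst M) V.
  by apply: (rho_Rint_le tf tM) => // x _ _; have /andP[] := tf.2 x.
by move/le_trans; apply; rewrite rho_Rint_cst// rho_Rint1_g_prob// V0 !mulr0.
Qed.

Lemma rho_Rint_ae_eq M f V V' : bounded_mfun M f -> measurable V -> measurable V' ->
  mu (V `\` V') = 0%E -> mu (V' `\` V) = 0%E -> rho_Rint f V = rho_Rint f V'.
Proof.
move=> tf mV mV' VV' V'V; rewrite /rho_Rint; congr fine.
have f0 x : (0 <= (f x * rho x)%:E)%E.
  by rewrite lee_fin mulr_ge0 ?rho_ge0//; have /andP[] := tf.2 x.
have mf A : measurable_fun A (fun x => (f x * rho x)%:E).
  by apply: measurable_funTS; apply: measurable_mulr_rho; exact: tf.1.
have split A B : measurable A -> measurable B -> mu (A `\` B) = 0%E ->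
    rho_int f A = rho_int f (A `&` B).
  move=> mA mB AB0; have mD : measurable (A `\` B) by exact: measurableD.
  rewrite /rho_int -[in LHS](setUIDK A B) ge0_integral_setU//.
  - by rewrite -!/(rho_int _ _) (rho_int_null tf mD AB0) adde0.
  - exact: measurableI.
  - by rewrite disj_set2E; apply/eqP/seteqP; split=> // x [[_ Bx] [_]].
by rewrite (split _ _ mV mV' VV') (split _ _ mV' mV V'V) setIC.
Qed.

(** Let [P] be the set where the density [f] of [nu] exceeds 1 and [Q] its
    preimage. By invariance [P `\` Q] and [Q `\` P] have the same mass, for
    [nu] and for [mu]. Off [P] the measure [nu] is at most [mu], so
    [nu (P `\` Q) = nu (Q `\` P) <= mu (Q `\` P) = mu (P `\` Q)], although
    [f > 1] on [P `\` Q]: this set is null. Hence [P] is invariant up to a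
    null set, so it is null or conull. If it is null then [nu <= mu], if it is
    conull then [mu <= nu]. *)
Lemma invariant_probability_unique (nu : probability (measurableTypeR R) R) :
  equivalent_to_dx nu -> preserved_by_g nu ->
  forall A, measurable A -> nu A = mu A.
Proof.
move=> [nudx _] nug.
have numu : nu `<< mu by apply: null_dominates_trans nudx (proj2 (@g_prob_equivalent R)).
pose f := Radon_Nikodym_SigmaFinite.f nu mu.
have mf : measurable_fun setT f.
  exact: measurable_int (Radon_Nikodym_SigmaFinite.f_integrable numu).
have f0 x : (0 <= f x)%E by exact: Radon_Nikodym_SigmaFinite.f_ge0.
pose P : set (measurableTypeR R) := f @^-1` `]1%E, +oo[ `&` @circle R.
have PC : P `<=` @circle R by move=> x [].
have f1 x : P x -> (1 < f x)%E by move=> [/=]; rewrite in_itv/= andbT.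
have mP : measurable P.
  apply: measurableI; last exact: measurable_circle.
  by rewrite -[X in measurable X]setTI; apply: mf => //; exact: emeasurable_itv.
have mC : measurable (~` @circle R) by apply: measurableC; exact: measurable_circle.
have outC : nu (~` @circle R) = 0%E.
  move/null_content_dominatesP : nudx; apply => //.
  change (lebesgue_measure (~` @circle R `&` @circle R) = 0%E).
  by rewrite setICl measure0.
have muE A : measurable A -> (mu A = \int[mu]_(x in A) cst 1 x)%E.
  by move=> mA; rewrite integral_cst// mul1e.
have above A : measurable A -> A `<=` P -> (mu A <= nu A)%E.
  move=> mA AP; rewrite (Radon_Nikodym_SigmaFinite.f_integral numu)// muE//.
  apply: ge0_le_integral => //; first exact: measurable_funTS.
  by move=> x /AP/f1/ltW.
have below A : measurable A -> A `<=` @circle R -> A `&` P = set0 -> (nu A <= mu A)%E.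
  move=> mA AC AP; rewrite (Radon_Nikodym_SigmaFinite.f_integral numu)// muE//.
  apply: ge0_le_integral => //; first exact: measurable_funTS.
  move=> x Ax /=; rewrite leNgt; apply/negP => fx.
  have : (A `&` P) x by split => //; split; [rewrite /= in_itv/= andbT|exact: AC].
  by rewrite AP.
have mQ := measurable_g_preimage mP; set Q := g_preimage P in mQ.
have QC : Q `<=` @circle R.
  by move=> x [[/andP[x0 x1] _] _]; rewrite /circle /= in_itv/= x1 ltW.
have mPQ : measurable (P `\` Q) by exact: measurableD.
have mQP : measurable (Q `\` P) by exact: measurableD.
have swap (la : probability (measurableTypeR R) R) : preserved_by_g la ->
    la (P `\` Q) = la (Q `\` P).
  move=> lag; have := lag _ mP PC; rewrite -/Q.
  rewrite (measureDI la mQ mP) (measureDI la mP mQ) (setIC Q P).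
  have mI : measurable (P `&` Q) by exact: measurableI.
  rewrite -(fineK (fin_num_measure la _ mI)) -(fineK (fin_num_measure la _ mPQ)).
  rewrite -(fineK (fin_num_measure la _ mQP)) -!EFinD => -[] h.
  rewrite -[LHS](fineK (fin_num_measure la _ mPQ)) -[RHS](fineK (fin_num_measure la _ mQP)).
  by congr EFin; lra.
have PQ0 : mu (P `\` Q) = 0%E.
  apply: (Radon_Nikodym_gt1_null numu) => //; first by move=> x [/f1].
  have e1 := swap nu nug; have e2 := swap mu (@g_prob_preserved R).
  change (nu (P `\` Q) <= mu (P `\` Q))%E; rewrite e1 e2.
  apply: below => //; last by rewrite setDE -setIA setICl setI0.
  by apply: subset_trans QC; exact: subDsetl.
have QP0 : mu (Q `\` P) = 0%E by rewrite -(swap mu (@g_prob_preserved R)).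
have invP M h : bounded_mfun M h -> rho_Rint h (g_preimage P) = rho_Rint h P.
  by move=> th; apply: (rho_Rint_ae_eq th).
have [q0|q1] := invariant_set_trivial mP invP.
  have muP : mu P = 0%E by have h := g_probE mP; rewrite q0 mul0r in h; exact: h.
  have nuP : nu P = 0%E by move/null_content_dominatesP : numu; apply.
  apply: probability_le_eq => A mA.
  pose A' : set (measurableTypeR R) := (A `&` @circle R) `\` P.
  have mAC : measurable (A `&` @circle R) by apply: measurableI => //; exact: measurable_circle.
  have mA' : measurable A' by exact: measurableD.
  apply: (@le_trans _ _ (nu (A' `|` (P `|` ~` @circle R)))).
    apply: le_measure; rewrite ?inE//; first by do 2 apply: measurableU => //.
    move=> x Ax; have [Px|nP] := pselect (P x); first by right; left.
    by have [Cx|nC] := pselect (@circle R x); [left|right; right].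
  apply: (@le_trans _ _ (nu A')).
    apply: le_trans (measureU2 _ _ _) _ => //; first exact: measurableU.
    rewrite -[leRHS]adde0 leeD2l//.
    have h : (nu (P `|` ~` @circle R) <= nu P + nu (~` @circle R))%E by exact: measureU2.
    by rewrite nuP outC adde0 in h; exact: h.
  apply: (@le_trans _ _ (mu A')).
    apply: below => //; last by rewrite /A' setDE -setIA setICl setI0.
    by move=> x [[]].
  by apply: le_measure; rewrite ?inE// => x [[]].
have muP : mu (~` P) = 0%E.
  have mu1 : mu P = 1%E.
    have h := g_probE mP; rewrite q1 divff in h; first exact: h.
    by rewrite gt_eqF//; have /andP[? _] := @total_mass_bounds R; lra.
  by rewrite (probability_setC mu mP) mu1 subee.
move=> A mA; apply/esym; apply: probability_le_eq mA => {}A mA.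
have mAP : measurable (A `&` P) by exact: measurableI.
have mAnP : measurable (~` P) by exact: measurableC.
apply: (@le_trans _ _ (mu ((A `&` P) `|` ~` P))).
  apply: le_measure; rewrite ?inE//; first exact: measurableU.
  by move=> x Ax; have [Px|nP] := pselect (P x); [left|right].
have h : (mu ((A `&` P) `|` ~` P) <= mu (A `&` P) + mu (~` P))%E by exact: measureU2.
rewrite muP adde0 in h; apply: (le_trans h).
apply: le_trans (above _ mAP _) _; first by move=> x [].
by apply: le_measure; rewrite ?inE// => x [].
Qed.

End Uniqueness.

Theorem theorem1 (R : realType) :
  exists mu : probability (measurableTypeR R) R,
    [/\ equivalent_to_dx mu /\ preserved_by_g mu,
        forall nu : probability (measurableTypeR R) R,
          equivalent_to_dx nu -> preserved_by_g nu ->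
          forall A : set (measurableTypeR R), measurable A -> nu A = mu A,
        (Lnorm mu +oo (dx_dmu mu) < +oo)%E,
        (Lnorm (@dx R) +oo (dmu_dx mu) < +oo)%E &
        exponentially_CF_mixing mu].
Proof.
exists (@g_prob R).
(* The supremum is over a nonempty set of nonnegative numbers: take the circle
   for [U] and for [V]. *)
have psi0 r : (0 <= psi (@g_prob R) r)%E.
  apply: ereal_sup_ge; exists (`|fine (@g_prob R (@circle R `&` iter (1 + r - 1)
      (@g_preimage R) (@circle R))) / (fine (@g_prob R (@circle R)) *
      fine (@g_prob R (@circle R))) - 1|)%:E; last by rewrite lee_fin.
  have C1 : (0 < @g_prob R (@circle R))%E.
    rewrite lt0e measure_ge0 andbT; apply/eqP => C0.
    have := dx_le_g_prob (@measurable_circle R); rewrite C0 mule0.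
    change (~ (lebesgue_measure (@circle R `&` @circle R) <= 0)%E).
    by rewrite setIid lebesgue_measure_itv/= lte_fin ltr01 oppr0 adde0 lee_fin ler10.
  exists 1%N, (@circle R), (@circle R); split => //.
    by split => // C [[C0 CD _] _]; rewrite -(setD0 (@circle R)); exact: CD.
  by split => //; exact: measurable_circle.
split.
- by split; [exact: g_prob_equivalent|exact: g_prob_preserved].
- exact: invariant_probability_unique.
- apply: (@Lnorm_Radon_Nikodym_lty _ _ _ _ _ (8 / 3)); first by rewrite divr_ge0.
  by move=> A mA; exact: dx_le_g_prob.
- apply: (@Lnorm_Radon_Nikodym_lty _ _ _ _ _ (8 / 3)); first by rewrite divr_ge0.
  by move=> A mA; exact: g_prob_le_dx.
split; last first.
  exists 100, (71 / 72); split => //; first by apply/andP; split; lra.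
  by move=> r; exact: psi_le.
split; first by apply: le_lt_trans (psi_le _) (ltry _).
apply: (@squeeze_cvge _ _ _ _ (cst 0%E) _ (fun r => (100 * (71 / 72) ^+ r)%:E)).
- near=> r; rewrite psi0/=; apply: psi_le; near: r; exact: nbhs_infty_ge.
- exact: cvg_cst.
apply: cvg_EFin; first by near=> r.
rewrite -[X in _ --> X](mulr0 100); apply: cvgM; first exact: cvg_cst.
by apply: cvg_expr; rewrite ger0_norm ?divr_ge0// ltr_pdivrMr//; lra.
Unshelve. all: by end_near. Qed.
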